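(* Let $L$ be a lattice of signature $(2,n)$, let $0<p\leq n$ be an integer and let $m>0$ be an even number. There exists a natural $\mathrm{O}^+(L_{\mathbb{R}})$-equivariant embedding $$\mathcal{L}^{\otimes pm}\hookrightarrow(\mathrm{Sym}^2\Omega^p_{\mathcal{D}})^{\otimes m/2}\subset(\Omega^p_{\mathcal{D}})^{\otimes m}.$$ Over each point $x\in\mathcal{D}$, the image of this embedding is $$\Bigl(\mathcal{L}_x^{\otimes 2p}\otimes\sum_I e_I^2\Bigr)^{\otimes m/2},$$ where $e_1,\dots,e_n$ is an orthonormal basis of $\mathcal{E}_x$, $e_I=e_{i_1}\wedge\cdots\wedge e_{i_p}$ for $I=\{i_1,\dots,i_p\}$, and $I$ runs over all subsets of $\{1,\dots,n\}$ consisting of $p$ elements.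
   Context: For a lattice $L$ (nondegenerate integral symmetric bilinear form) of signature $(2,n)$ let $L_K=L\otimes_{\mathbb{Z}}K$, let $Q\subset\mathbb{P}L_{\mathbb{C}}$ be the quadric $(\omega,\omega)=0$, and let $\mathcal{D}$ be one of the two connected components of $\{[\omega]\in Q:(\omega,\bar\omega)>0\}$. $\mathrm{O}^+(L_{\mathbb{R}})\subset\mathrm{O}(L_{\mathbb{R}})$ is the subgroup preserving $\mathcal{D}$. Let $\mathcal{L}=\mathcal{O}_{\mathbb{P}L_{\mathbb{C}}}(-1)|_{\mathcal{D}}\subset L_{\mathbb{C}}\otimes\mathcal{O}_{\mathcal{D}}$ and $\mathcal{E}=\mathcal{L}^\perp/\mathcal{L}$, an $\mathrm{O}^+(L_{\mathbb{R}})$-equivariant vector bundle of rank $n$ with the nondegenerate quadratic form induced from that of $L_{\mathbb{C}}$. There is an isomorphism $\Omega^p_{\mathcal{D}}\simeq\mathcal{L}^{\otimes p}\otimes\wedge^p\mathcal{E}$ (from $T\mathcal{D}\simeq\mathcal{L}^\vee\otimes\mathcal{E}$ and $\mathcal{E}^\vee\simeq\mathcal{E}$), under which $\mathrm{Sym}^2\Omega^p_{\mathcal{D}}\simeq\mathcal{L}^{\otimes2p}\otimes\mathrm{Sym}^2(\wedge^p\mathcal{E})$; the description of the image is in these terms. *)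

(* Defs.v *)
From HB Require Import structures.
From mathcomp Require Import all_boot all_order all_fingroup all_algebra.
From mathcomp Require Import all_classical all_reals all_analysis.
From mathcomp Require Import complex ring.

Set Implicit Arguments.
Unset Strict Implicit.
Unset Printing Implicit Defensive.

Import Order.TTheory GRing.Theory Num.Theory.
Import numFieldNormedType.Exports.
Local Open Scope classical_set_scope.
Local Open Scope ring_scope.
Local Open Scope complex_scope.

Section Tensors.
Variable K : fieldType.
Implicit Types V W : vectType K.

Definition dual V : vectType K := 'Hom(V, K^o).

(* V ⊗ W, realised as Hom(V^∨, W) (V and W are finite dimensional):
   the pure tensor v ⊗ w is the map l |-> l(v) w. *)
Definition tens V W : vectType K := 'Hom(dual V, W).

Definition pure V W (v : V) (w : W) : tens V W :=
  linfun (fun l : dual V => l v *: w).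

Lemma dim_tens V W : \dim {:tens V W} = (\dim {:V} * \dim {:W})%N.
Proof. by rewrite !dimvf -[X in X = _]/(dim V * 1 * dim W)%N muln1. Qed.

(* The map f ⊗ h on tensors; in terms of Hom's it sends t to h o t o f^T. *)
Definition tmap V V' W W' (f : 'Hom(V, V')) (h : 'Hom(W, W')) :
    'Hom(tens V W, tens V' W') :=
  linfun (fun t : tens V W =>
    linfun (fun l : dual V' => h (t (l \o f)%VF)) : tens V' W').

Fixpoint tpow V k : vectType K :=
  if k is k'.+1 then tens V (tpow V k') else K^o.

Fixpoint tprod V k : ('I_k -> V) -> tpow V k :=
  match k with
  | 0 => fun _ => 1
  | k'.+1 => fun v => pure (v ord0) (tprod (fun i => v (lift ord0 i)))
  end.

Fixpoint tpow_map V W (f : 'Hom(V, W)) k : 'Hom(tpow V k, tpow W k) :=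
  match k with
  | 0 => \1%VF
  | k'.+1 => tmap f (tpow_map f k')
  end.

(* The product of the tensor algebra; the degree of the result is
   convertible to k.+1 + l in the recursive case. *)
Fixpoint tmul V k l : tpow V k -> tpow V l -> tpow V (k + l) :=
  match k with
  | 0 => fun (c : K^o) t => (c : K) *: t
  | k'.+1 => fun s t => linfun (fun f : dual V => tmul ((s : tens _ _) f) t)
  end.

(* Exterior powers, as the subspaces of antisymmetric tensors
   (in characteristic 0). *)
Definition alt V k (v : 'I_k -> V) : tpow V k :=
  \sum_(s : 'S_k) (-1) ^+ s *: tprod (v \o s).

Definition ext_sub k V : {vspace tpow V k} :=
  <<[seq alt (fun a => (vbasis {:V})`_(f a))
      | f : {ffun 'I_k -> 'I_(\dim {:V})}]>>%VS.

Definition ext k V : vectType K := subvs_of (ext_sub k V).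

Definition wedge V k (v : 'I_k -> V) : ext k V := vsproj (ext_sub k V) (alt v).

Definition ext_map V W (f : 'Hom(V, W)) k : 'Hom(ext k V, ext k W) :=
  linfun (fun t : ext k V => vsproj (ext_sub k W) (tpow_map f k (vsval t))).

(* Sym^2 V, as the subspace of V ⊗ V of symmetric tensors
   (in characteristic 0). *)
Definition pure2 V (u v : V) : tpow V 2 := pure u (pure v (1 : K^o)).

Definition sym2 V : {vspace tpow V 2} :=
  <<[seq (pure2 u v + pure2 v u)%R | u <- vbasis {:V}, v <- vbasis {:V}]>>%VS.

(* For m even, the subspace (Sym^2 V)^{⊗m/2} of V^{⊗m};
   meaningless when m is odd. *)
Fixpoint sym2_pow V m : {vspace tpow V m} :=
  match m with
  | 0 => fullv
  | 1 => 0%VS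
  | m'.+2 => <<[seq (@tmul V 2 m' s t : tpow V m'.+2)
                 | s <- vbasis (sym2 V), t <- vbasis (sym2_pow V m')]>>%VS
  end.

(* For m even and s in V ⊗ V, the tensor s^{⊗m/2} of V^{⊗m};
   meaningless when m is odd. *)
Fixpoint half_pow V (s : tpow V 2) m : tpow V m :=
  match m with
  | 0 => (1 : K^o)
  | 1 => 0
  | m'.+2 => @tmul V 2 m' s (half_pow s m')
  end.

(* The quotient V / U.  It is carried by the complement U^C of the library;
    [vquot_ker] and [vquotK] say that [vpi U] is a surjection with kernel U. *)

Definition vquot V (U : {vspace V}) : vectType K := subvs_of (U^C)%VS.

Definition vpi V (U : {vspace V}) : 'Hom(V, vquot U) :=
  (linfun (vsproj (U^C)%VS) \o daddv_pi (U^C) U)%VF.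

Definition vlift V (U : {vspace V}) (u : vquot U) : V := vsval u.

Lemma vquotK V (U : {vspace V}) : cancel (@vlift V U) (vpi U).
Proof.
move=> u; rewrite /vpi comp_lfunE lfunE /= /vlift daddv_pi_id ?subvsP ?vsvalK //.
by rewrite capvC capv_compl.
Qed.

Lemma vquot_ker V (U : {vspace V}) : lker (vpi U) = U.
Proof.
have cU : (U :&: U^C = 0)%VS := capv_compl U.
have dec v : daddv_pi U (U^C)%VS v + daddv_pi (U^C)%VS U v = v.
  by apply: daddv_pi_add; rewrite ?addv_complf ?memvf.
apply/vspaceP => v; rewrite memv_ker /vpi comp_lfunE lfunE /=.
apply/eqP/idP => [h|Uv].
  rewrite -(dec v) -(vsprojK (memv_pi (U^C)%VS U v)) h linear0 addr0.
  exact: memv_pi.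
have /eqP := dec v; rewrite daddv_pi_id // addrC eq_sym -subr_eq subrr.
by move/eqP <-; rewrite linear0.
Qed.

End Tensors.

(* A lattice with a chosen Z-basis, given by its Gram matrix. *)
Record lattice (N : nat) := Lattice {
  gram : 'M[int]_N;
  gram_sym : gram^T = gram;
  gram_nondeg : \det gram != 0
}.

Definition gram_in (K : nzRingType) N (L : lattice N) : 'M[K]_N :=
  map_mx intr (gram L).

Definition has_signature (R : realType) N (L : lattice N) (r s : nat) :=
  (r + s)%N = N /\
  exists2 P : 'M[R]_N, P \in unitmx &
    P^T *m gram_in R L *m P
    = diag_mx (\row_(i < N) if (i < r)%N then 1 else -1).

(* Points of P(K^N) are the lines of K^N. *)
Definition projsp (K : numFieldType) (N : nat) : Type :=
  {l : {vspace 'cV[K]_N} | \dim l == 1%N}.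
HB.instance Definition _ (K : numFieldType) (N : nat) := Choice.on (projsp K N).

Section ProjTopology.
Variables (K : numFieldType) (N : nat).
Local Notation P := (projsp K N).

Lemma projP (x y : P) (w : 'cV[K]_N) :
  w \in val x -> w \in val y -> w != 0 -> x = y.
Proof.
move=> wx wy w0; apply: val_inj.
have line (z : P) : w \in val z -> val z = <[w]>%VS.
  move=> wz; apply/esym/eqP; rewrite eqEdim -memvE wz dim_vline w0.
  by rewrite (eqP (valP z)).
by rewrite (line x) // (line y).
Qed.

Definition cone_over (U : set P) : set 'cV[K]_N :=
  [set w | w != 0 /\ exists2 x : P, U x & w \in val x].

(* The quotient topology from K^N \ {0}. *)
Definition proj_open : set_system P := [set U | open (cone_over U)].

Let proj_openT : proj_open setT.
Proof.
rewrite /proj_open /=.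
have -> : cone_over setT = ~` [set 0].
  apply/seteqP; split=> w; first by case=> /eqP.
  move=> /= /eqP w0; split=> //.
  have dw : \dim <[w]>%VS == 1%N by rewrite dim_vline w0.
  by exists (exist _ <[w]>%VS dw) => //=; exact: memv_line.
by rewrite openC; exact/accessible_closed_set1/hausdorff_accessible/norm_hausdorff.
Qed.

Let proj_openI : setI_closed proj_open.
Proof.
move=> A B oA oB; rewrite /proj_open /=.
have -> : cone_over (A `&` B) = cone_over A `&` cone_over B.
  apply/seteqP; split=> w.
    by case=> w0 [x [Ax Bx] wx]; split; split=> //; exists x.
  case=> -[w0 [x Ax wx]] [_ [y By wy]]; split=> //; exists x => //.
  by split=> //; rewrite (projP wx wy w0).
exact: openI.
Qed.

Let proj_open_bigU (I : Type) (f : I -> set P) :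
  (forall i, proj_open (f i)) -> proj_open (\bigcup_i f i).
Proof.
move=> of_; rewrite /proj_open /=.
have -> : cone_over (\bigcup_i f i) = \bigcup_i cone_over (f i).
  apply/seteqP; split=> w.
    by case=> w0 [x [i _ fx] wx]; exists i => //; split=> //; exists x.
  by case=> i _ [w0 [x fx wx]]; split=> //; exists x => //; exists i.
by apply: bigcup_open => i _; exact: of_.
Qed.

HB.instance Definition _ :=
  isOpenTopological.Build P proj_openT proj_openI proj_open_bigU.

End ProjTopology.

Section Domain.
Variables (R : realType) (n : nat) (L : lattice n.+2).
Local Notation C := R[i].
Local Notation V := 'cV[C]_n.+2.
Local Notation Vn := ('cV[C]_n.+2 : normedModType C).
Local Notation PV := (projsp R[i] n.+2).

(* The C-bilinear form of L_C. *)
Definition form (v w : V) : C := (v^T *m gram_in C L *m w) ord0 ord0.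

Definition conjv (w : V) : V := map_mx (@conjc R) w.

Definition quadric : set PV :=
  [set x : PV | forall w, w \in val x -> form w w = 0].

Definition Dpm : set PV :=
  [set x : PV | quadric x /\
    forall w, w \in val x -> w != 0 -> 0 < form w (conjv w)].

Definition is_domain (D : set PV) :=
  exists2 x, Dpm x & D = connected_component Dpm x.

Definition orthv (U : {vspace V}) : {vspace V} :=
  (\bigcap_(i < \dim U) lker (linfun (form (vbasis U)`_i : V -> C^o)))%VS.

Lemma formDl u v w : form (u + v) w = form u w + form v w.
Proof. by rewrite /form linearD /= !mulmxDl mxE. Qed.

Lemma formZl a v w : form (a *: v) w = a * form v w.
Proof. by rewrite /form linearZ /= -!scalemxAl mxE. Qed.

Lemma formC v w : form v w = form w v.
Proof.
have tr (M : 'M[C]_1) : M ord0 ord0 = M^T ord0 ord0 by rewrite mxE.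
have gT : (gram_in C L)^T = gram_in C L.
  by rewrite /gram_in -[in RHS](gram_sym L) matrix.map_trmx.
by rewrite /form tr !trmx_mul trmxK gT mulmxA.
Qed.

Lemma formDr u v w : form w (u + v) = form w u + form w v.
Proof. by rewrite formC formDl !(formC w). Qed.

Lemma formZr a v w : form w (a *: v) = a * form w v.
Proof. by rewrite formC formZl (formC w). Qed.

Lemma orthvP (U : {vspace V}) v :
  v \in orthv U <-> forall w, w \in U -> form w v = 0.
Proof.
have lin_form w : linear (form w : V -> C^o).
  by move=> a u u'; rewrite formDr formZr.
have kerP w : (v \in lker (linfun (form w : V -> C^o))) = (form w v == 0).
  pose f : {linear V -> C^o} :=
    HB.pack (form w : V -> C^o) (GRing.isLinear.Build _ _ _ _ _ (lin_form w)).
  by rewrite memv_ker; have /= -> := lfunE f v.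
rewrite memvE /orthv; split=> [/subv_bigcapP Uv w /coord_vbasis -> |Uv].
  rewrite formC; elim/big_rec: _ => [|i u _ IH].
    by rewrite formC -[0](scale0r 0) formZl mul0r.
  rewrite formDr formZr IH addr0 formC.
  by have := Uv i isT; rewrite -memvE kerP => /eqP ->; rewrite mulr0.
apply/subv_bigcapP => i _; rewrite -memvE kerP Uv //.
by apply: vbasis_mem; rewrite mem_nth // size_tuple.
Qed.

(* The tangent space of the cone (w, w) = 0 at w is the orthogonal of w. *)
Lemma tangent_cone (w v : Vn) :
  'D_v (fun u : Vn => form u u : C^o) w = 0 <-> form w v = 0.
Proof.
have -> : 'D_v (fun u : Vn => form u u : C^o) w = 2 * form w v.
  apply/cvg_lim; first exact: norm_hausdorff.
  have h2 : (fun h : C^o => (2 * form w v : C^o) + h *: (form v v : C^o))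
              @ (0 : C^o)^' --> (2 * form w v : C^o) + 0 *: (form v v : C^o).
    apply: cvgD; first exact: cvg_cst.
    by apply: cvgZr_tmp; apply: cvg_within_filter; exact: cvg_id.
  rewrite scale0r addr0 in h2.
  apply: cvg_trans h2; apply: near_eq_cvg.
  near=> h.
  have h0 : h != 0 by near: h; exact: nbhs_dnbhs_neq.
  rewrite /= /GRing.scale /= !formDl !formDr !formZl !formZr (formC v w).
  by field.
split=> [/eqP|->]; last by rewrite mulr0.
by rewrite mulf_eq0 pnatr_eq0 => /eqP.
Unshelve. all: by end_near.
Qed.

Record orthR := OrthR {
  orth_mx : 'M[R]_n.+2;
  orth_mxP : orth_mx^T *m gram_in R L *m orth_mx = gram_in R L
}.

Definition orth_lin (g : orthR) : 'End(V) :=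
  linfun (mulmx (map_mx (real_complex R) (orth_mx g)) : V -> V).

Lemma orth_unit (g : orthR) : orth_mx g \in unitmx.
Proof.
rewrite unitmxE unitfE; apply/eqP => g0.
have /(congr1 determinant) := orth_mxP g.
rewrite !det_mulmx g0 mulr0 /gram_in det_map_mx => /esym/eqP.
by rewrite intr_eq0; apply/negP/gram_nondeg.
Qed.

Lemma orth_lin_inj (g : orthR) : lker (orth_lin g) = 0%VS.
Proof.
apply/eqP/lker0P => u v; rewrite !lfunE /=.
have gu : map_mx (real_complex R) (orth_mx g) \in unitmx.
  by rewrite map_unitmx orth_unit.
by move=> /(congr1 (mulmx (invmx (map_mx (real_complex R) (orth_mx g)))));
   rewrite !mulKmx.
Qed.

Lemma orth_proj_subproof (g : orthR) (x : PV) :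
  \dim (orth_lin g @: val x)%VS == 1%N.
Proof.
by rewrite limg_dim_eq ?(eqP (valP x)) // orth_lin_inj capv0.
Qed.

Definition orth_proj (g : orthR) (x : PV) : PV :=
  exist _ (orth_lin g @: val x)%VS (orth_proj_subproof g x).

Section Bundles.
Variable D : set PV.

Record Oplus := OPlus {
  oplus_orth :> orthR;
  oplusP : forall x, D (orth_proj oplus_orth x) <-> D x
}.

Lemma oplus_act_subproof (g : Oplus) (x : D) : orth_proj g (val x) \in D.
Proof. by apply/mem_set/oplusP/set_mem; exact: (valP x). Qed.

Definition oplus_act (g : Oplus) (x : D) : D :=
  exist _ (orth_proj g (val x)) (oplus_act_subproof g x).

Definition line (x : D) : {vspace V} := val (val x).

(* A map s on D is holomorphic near x when its pull-back to the cone over D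
   is, near the nonzero vectors of the line x, the restriction of a
   holomorphic map of an open subset of L_C. *)
Definition hol_map (W : normedModType C) (x : D) (s : D -> W) : Prop :=
  forall w : Vn, w \in line x -> w != 0 ->
  exists2 F : Vn -> W,
    \forall v \near w, differentiable F v &
    \forall v \near w, forall y : D, v \in line y -> s y = F v.

(* A holomorphic vector bundle on D with an action of O^+(L_R): its fibres,
   the sections that are holomorphic in a neighbourhood of a given point, and
   the action g : F_x -> F_{gx}.  Only bundles obtained from the trivial
   bundles L_C and C by the constructions below are used. *)
Record bundle := Bundle {
  fib :> D -> vectType C;
  hol : D -> (forall y, fib y) -> Prop;
  act : forall (g : Oplus) x, 'Hom(fib x, fib (oplus_act g x))
}.
Arguments hol : clear implicits.
Arguments act : clear implicits.

Definition triv_one : bundle :=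
  @Bundle (fun _ => C^o) (@hol_map C^o) (fun _ _ => \1%VF).

Definition triv_L : bundle :=
  @Bundle (fun _ => V) (@hol_map V) (fun g _ => orth_lin g).

Definition homB (F G : bundle) : bundle :=
  @Bundle (fun x => 'Hom(F x, G x))
    (fun x phi => forall s, hol F x s -> hol G x (fun y => phi y (s y)))
    (fun g x => linfun (fun phi : 'Hom(F x, G x) =>
       (act G g x \o phi \o (act F g x)^-1)%VF)).

Definition dualB (F : bundle) : bundle := homB F triv_one.

(* [tens (F y) W] is a Hom from the dual of F y, whence the holomorphy. *)
Fixpoint tpow_hol (F : bundle) k (x : D) :
    (forall y, tpow (F y) k) -> Prop :=
  match k with
  | 0 => hol triv_one x
  | k'.+1 => fun s => forall l : (forall y, dual (F y)),
      hol (dualB F) x l ->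
      tpow_hol x (fun y => (s y : tens (F y) (tpow (F y) k')) (l y))
  end.

Definition tpowB (F : bundle) k : bundle :=
  @Bundle (fun x => tpow (F x) k) (@tpow_hol F k)
    (fun g x => tpow_map (act F g x) k).

Definition subB (F : bundle) (S : forall x, {vspace F x}) : bundle :=
  @Bundle (fun x => subvs_of (S x))
    (fun x s => hol F x (fun y => vsval (s y)))
    (fun g x => linfun (fun u : subvs_of (S x) =>
       vsproj (S (oplus_act g x)) (act F g x (vsval u)))).

Definition quoB (F : bundle) (S : forall x, {vspace F x}) : bundle :=
  @Bundle (fun x => vquot (S x))
    (fun x s => exists2 t : (forall y, F y), hol F x t &
       \forall y \near x, s y = vpi (S y) (t y))
    (fun g x => linfun (fun u : vquot (S x) =>
       vpi (S (oplus_act g x)) (act F g x (vlift u)))).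

Definition extB k (F : bundle) : bundle :=
  subB (F := tpowB F k) (fun x => ext_sub k (F x)).

Definition calL : bundle := subB (F := triv_L) line.

Definition calLperp : bundle := subB (F := triv_L) (fun x => orthv (line x)).

Definition calE : bundle :=
  quoB (F := calLperp)
    (fun x => (linfun (vsval : subvs_of (orthv (line x)) -> V)
                 @^-1: line x)%VS).

(* The form induced on E_x = x^⊥/x: computed on lifts, see [formE_pi]. *)
Definition formE (x : D) (u v : calE x) : C :=
  form (vsval (vlift u)) (vsval (vlift v)).

Lemma formE_pi (x : D) (u v : calLperp x) : quadric (val x) ->
  formE (vpi _ u : calE x) (vpi _ v : calE x) = form (vsval u) (vsval v).
Proof.
move=> qx; rewrite /formE.
set S := (X in vpi X); pose r (u : calLperp x) := vlift (vpi S u) : calLperp x.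
have rE (u' : calLperp x) : vsval (r u') - vsval u' \in line x.
  have : r u' - u' \in S.
    by rewrite -(vquot_ker S) memv_ker linearB /= /r vquotK subrr.
  by rewrite /S -memv_preim linearB /= !lfunE.
have ort (w : V) (u' : calLperp x) : w \in line x -> form w (vsval u') = 0.
  by move=> wx; have /orthvP -> := subvsP u'.
have {}rE u' : exists2 w, w \in line x & vsval (r u') = vsval u' + w.
  by exists (vsval (r u') - vsval u') => //; rewrite addrC subrK.
rewrite -/(r u) -/(r v).
have [w wx ->] := rE u; have [w' w'x rv] := rE v.
by rewrite formDl (ort w (r v)) // addr0 rv formDr (formC _ w') (ort w') // addr0.
Qed.

(* The tangent bundle of the quadric: T_x P(V) = Hom(x, V/x), and by
   [tangent_cone] the tangent space of the cone (w, w) = 0 at a nonzero w in x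
   is x^⊥, so T_x D = Hom(x, x^⊥/x). *)
Definition tangentB : bundle := homB calL calE.

Definition Omega p : bundle := extB p (dualB tangentB).

(* w ⊗ e, as an element of L_x ⊗ E_x = (L_x^∨ ⊗ E_x)^∨ = Ω^1_x, using E = E^∨ *)
Definition theta (x : D) (w : calL x) : 'Hom(calE x, dualB tangentB x) :=
  linfun (fun e : calE x =>
    linfun (fun phi : tangentB x => formE e (phi w) : C^o)
    : dualB tangentB x).

(* The isomorphism L_x^{⊗p} ⊗ ∧^p E_x -> Ω^p_x applied to w^{⊗p} ⊗ t. *)
Definition iso_Omega p (x : D) (w : calL x) : 'Hom(ext p (calE x), Omega p x) :=
  ext_map (theta w) p.

(* The isomorphism L_x^{⊗2p} ⊗ (∧^p E_x)^{⊗2} -> (Ω^p_x)^{⊗2}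
   applied to w^{⊗2p} ⊗ t. *)
Definition iso_Omega2 p (x : D) (w : calL x) :
    'Hom(tpow (ext p (calE x)) 2, tpow (Omega p x) 2) :=
  tpow_map (iso_Omega p w) 2.

Definition orthonormal_basis (x : D) (e : n.-tuple (calE x)) :=
  basis_of {:calE x} e /\
  forall i j : 'I_n, formE e`_i e`_j = (i == j)%:R.

(* e_I = e_{i_1} ∧ ... ∧ e_{i_p}, where i_1 < ... < i_p are the elements of I. *)
Definition e_ p (x : D) (e : n.-tuple (calE x)) (I : {set 'I_n}) :
    ext p (calE x) :=
  wedge (fun a : 'I_p => [seq e`_(i : 'I_n) | i <- enum I]`_a).

Definition sum_eI2 p (x : D) (e : n.-tuple (calE x)) :
    tpow (ext p (calE x)) 2 :=
  \sum_(I : {set 'I_n} | #|I| == p) pure2 (e_ p e I) (e_ p e I).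

Definition holomorphic (F G : bundle) (Phi : forall x, 'Hom(F x, G x)) :=
  forall x, hol (homB F G) x Phi.

Definition equivariant (F G : bundle) (Phi : forall x, 'Hom(F x, G x)) :=
  forall (g : Oplus) (x : D) (u : F x),
    Phi (oplus_act g x) (act F g x u) = act G g x (Phi x u).

Definition fiberwise_injective (F G : bundle)
    (Phi : forall x, 'Hom(F x, G x)) :=
  forall x, lker (Phi x) = 0%VS.

End Bundles.

End Domain.

(* Main.v *)
From HB Require Import structures.
From mathcomp Require Import all_boot all_order all_fingroup all_algebra.
From mathcomp Require Import all_classical all_reals all_analysis.
From mathcomp Require Import complex ring.
Require Import Defs.

Set Implicit Arguments.
Unset Strict Implicit.
Unset Printing Implicit Defensive.

Import Order.TTheory GRing.Theory Num.Theory.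
Import numFieldNormedType.Exports.
Local Open Scope ring_scope.
Local Open Scope complex_scope.

(** For w in L_x write θ_w(e) = w ⊗ e, an element of Ω^1_x, and let
    T_w = sum_I (θ_w e_I)^2 for an orthonormal basis e of E_x. The embedding
    sends w^{⊗pm} to T_w^{⊗m/2}, and the theorem rests on this tensor being
    canonical.

    T_w does not depend on e. Moving the permutations that define one of the two
    factors e_I to the other turns the sum over subsets I into a sum over all
    maps h from p to n ([sum_squaresE]); this sum is multilinear, so under an
    orthogonal change of basis A each index is contracted by A^T A = 1
    ([sum_squares_orthogonal]). When w is replaced by aw, both w^{⊗pm} and
    T_w^{⊗m/2} are multiplied by a^{pm}. Hence each fibre carries one linear map
    that is given by the same formula for every generator w and every
    orthonormal basis e ([exists_canonical_map]), and each required property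
    follows by choosing w and e well.

    The image is the line spanned by T_w^{⊗m/2}, a product of symmetric squares;
    it is nonzero because functionals dual to the e_i separate the e_I
    ([sum_squares_neq0]), which also gives injectivity. Equivariance holds
    because g carries a generator and an orthonormal basis at x to such data at
    gx, compatibly with θ ([theta_act]).

    Holomorphy needs a holomorphic orthonormal frame near x. Let w span x and let
    eta be the multiple of its complex conjugate with (w, eta) = 1; eta is
    isotropic. Let e_i be an orthonormal basis of the orthogonal of w and eta.
    For y near x let w_y be the vector of y with (w_y, eta) = 1. The vectors
    e_i - (e_i, w_y) eta are orthogonal to w_y, and they are orthonormal because
    eta is isotropic and orthogonal to the e_i ([frame_orthonormal]); they depend
    holomorphically on y ([hol_frame_sec]). Since holomorphic sections of tensor
    bundles are those with holomorphic contractions ([hol_tpowP]), the claim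
    becomes that sums and products of holomorphic functions are holomorphic. *)

(** * Tensors, wedges and symmetric squares *)

Section TensorAlgebra.
Variable K : fieldType.
Implicit Types V W : vectType K.

Lemma linfunE V W (f : V -> W) : linear f -> linfun f =1 f.
Proof.
move=> lf v.
pose f' : {linear V -> W} :=
  HB.pack f (GRing.isLinear.Build _ _ _ _ _ lf).
exact: (lfunE f').
Qed.

Lemma tensP V W a (t t' : tens V W) (l : dual V) :
  ((a *: t + t')%R : 'Hom(_, _)) l =
  a *: (t : 'Hom(_, _)) l + (t' : 'Hom(_, _)) l.
Proof. by rewrite add_lfunE scale_lfunE. Qed.

Lemma pureE V W (v : V) (w : W) (l : dual V) :
  (pure v w : 'Hom(_, _)) l = l v *: w.
Proof.
rewrite linfunE // => a l1 l2.
by rewrite add_lfunE scale_lfunE scalerDl -scalerA.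
Qed.

Lemma tmapE V V' W W' (f : 'Hom(V, V')) (h : 'Hom(W, W'))
    (t : tens V W) (l : dual V') :
  (tmap f h t : 'Hom(_, _)) l = h ((t : 'Hom(_, _)) (l \o f)%VF).
Proof.
have lin (t' : tens V W) :
    linear (fun l0 : dual V' => h ((t' : 'Hom(_, _)) (l0 \o f)%VF)).
  move=> a l1 l2.
  rewrite -linearP -linearP; congr (h (t' _)); apply/lfunP => v.
  by rewrite !(comp_lfunE, add_lfunE, scale_lfunE).
have lin2 : linear (fun t' : tens V W => linfun (fun l0 : dual V' =>
    h ((t' : 'Hom(_, _)) (l0 \o f)%VF)) : tens V' W').
  move=> a t1 t2; apply/lfunP => l0.
  rewrite tensP !(linfunE (lin _)) tensP.
  exact: linearP.
by rewrite /tmap (linfunE lin2) linfunE.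
Qed.

(** Tensors are compared, and their holomorphy is tested, through the scalars
    obtained by contracting every factor with a functional; [teval_inj] says
    that nothing is lost. *)
Fixpoint teval V k : tpow V k -> ('I_k -> dual V) -> K :=
  match k with
  | 0 => fun t _ => t
  | k'.+1 => fun t l =>
      teval ((t : tens V (tpow V k')) (l ord0)) (fun i => l (lift ord0 i))
  end.

Lemma eq_teval V k (t : tpow V k) l l' : l =1 l' -> teval t l = teval t l'.
Proof.
elim: k t l l' => //= k IH t l l' ll'.
by rewrite ll'; apply: IH => i; exact: ll'.
Qed.

Lemma teval_linear V k (l : 'I_k -> dual V) :
  linear (fun t : tpow V k => teval t l : K^o).
Proof.
elim: k l => [|k IH] l a t t' //=.
by rewrite add_lfunE scale_lfunE IH.
Qed.

Lemma tevalD V k (t t' : tpow V k) l : teval (t + t') l = teval t l + teval t' l.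
Proof. by have := teval_linear l 1 t t'; rewrite !scale1r. Qed.

Lemma teval0 V k l : teval (0 : tpow V k) l = 0.
Proof. by apply: (addrI (teval (0 : tpow V k) l)); rewrite -tevalD !addr0. Qed.

Lemma tevalZ V k a (t : tpow V k) l : teval (a *: t) l = a * teval t l.
Proof. by have := teval_linear l a t 0; rewrite addr0 teval0 addr0. Qed.

Lemma teval_sum V k I (r : seq I) P (F : I -> tpow V k) l :
  teval (\sum_(i <- r | P i) F i) l = \sum_(i <- r | P i) teval (F i) l.
Proof. by apply: (big_morph (fun t => teval t l)) => [t t'|]; rewrite ?tevalD ?teval0. Qed.

Lemma teval_tprod V k (v : 'I_k -> V) l :
  teval (tprod v) l = \prod_a l a (v a) :> K.
Proof.
elim: k v l => [|k IH] v l; first by rewrite big_ord0.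
by rewrite big_ord_recl /= pureE tevalZ IH.
Qed.

Lemma teval_inj V k (t t' : tpow V k) :
  (forall l, teval t l = teval t' l) -> t = t'.
Proof.
elim: k t t' => [|k IH] t t' tt'; first exact: (tt' (fun _ => 0)).
apply/lfunP => l; apply: IH => l'.
pose l0 i := if unlift ord0 i is Some j then l' j else l.
have := tt' l0; rewrite /= /l0 unlift_none.
rewrite (@eq_teval _ _ _ _ l') ?(@eq_teval _ _ _ (fun _ => _) l') //;
  by move=> i; rewrite liftK.
Qed.

Lemma teval_tpow_map V W (f : 'Hom(V, W)) k (t : tpow V k) l :
  teval (tpow_map f k t) l = teval t (fun a => (l a \o f)%VF).
Proof.
elim: k t l => [|k IH] t l /=; first by rewrite id_lfunE.
by rewrite tmapE IH.
Qed.

Lemma teval_scale V k (t : tpow V k) (c : 'I_k -> K) l :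
  teval t (fun a => c a *: l a) = (\prod_a c a) * teval t l.
Proof.
elim: k t c l => [|k IH] t c l; first by rewrite big_ord0 mul1r.
by rewrite big_ord_recl /= linearZ /= IH tevalZ mulrCA mulrA.
Qed.

Lemma tpow_map_tprod V W (f : 'Hom(V, W)) k (v : 'I_k -> V) :
  tpow_map f k (tprod v) = tprod (f \o v).
Proof.
apply: teval_inj => l; rewrite teval_tpow_map !teval_tprod.
by apply: eq_bigr => a _; rewrite comp_lfunE.
Qed.

Lemma tpow_map_alt V W (f : 'Hom(V, W)) k (v : 'I_k -> V) :
  tpow_map f k (alt v) = alt (f \o v).
Proof.
rewrite /alt linear_sum; apply: eq_bigr => s _.
by rewrite linearZ /= tpow_map_tprod.
Qed.

Lemma eq_tprod V k (v v' : 'I_k -> V) : v =1 v' -> tprod v = tprod v'.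
Proof.
move=> vv'; apply: teval_inj => l; rewrite !teval_tprod.
by apply: eq_bigr => a _; rewrite vv'.
Qed.

Lemma eq_alt V k (v v' : 'I_k -> V) : v =1 v' -> alt v = alt v'.
Proof.
move=> vv'; apply: eq_bigr => s _; congr (_ *: _).
by apply: eq_tprod => a /=; rewrite vv'.
Qed.

(** The signed sum defining [alt] is the Leibniz formula, so antisymmetry,
    vanishing on repeated vectors and homogeneity of wedges are inherited from
    determinants. *)
Lemma teval_alt V k (v : 'I_k -> V) (l : 'I_k -> dual V) :
  teval (alt v) l = \det (\matrix_(a, b) (l a (v b) : K)).
Proof.
rewrite teval_sum; apply: eq_bigr => s _.
rewrite tevalZ teval_tprod; congr (_ * _).
by apply: eq_bigr => a _; rewrite mxE.
Qed.

Lemma alt_perm V k (v : 'I_k -> V) (s : 'S_k) :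
  alt (v \o s) = (-1) ^+ s *: alt v.
Proof.
apply: teval_inj => l; rewrite tevalZ !teval_alt.
rewrite -[(-1) ^+ s]/((-1) ^+ (s : bool)) -odd_permV -(det_perm _ s^-1%g) mulrC.
rewrite -det_mulmx -col_permE; congr (\det _).
by apply/matrixP => i j; rewrite !mxE.
Qed.

Lemma alt_repeat V k (v : 'I_k -> V) a b : a != b -> v a = v b -> alt v = 0.
Proof.
move=> ab vab; apply: teval_inj => l; rewrite teval0 teval_alt -det_tr.
by apply: (determinant_alternate ab) => c; rewrite !mxE vab.
Qed.

Lemma tprod_expand V k d (A : 'I_k -> 'I_d -> K) (b : 'I_d -> V) :
  tprod (fun a => \sum_j A a j *: b j) =
  \sum_(f : {ffun 'I_k -> 'I_d}) (\prod_a A a (f a)) *: tprod (b \o f).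
Proof.
apply: teval_inj => l; rewrite teval_tprod teval_sum.
under eq_bigr do rewrite linear_sum /=.
rewrite bigA_distr_bigA /=; apply: eq_bigr => f _.
rewrite tevalZ teval_tprod -big_split /=; apply: eq_bigr => a _.
by rewrite linearZ.
Qed.

Lemma alt_expand V k d (A : 'I_k -> 'I_d -> K) (b : 'I_d -> V) :
  alt (fun a => \sum_j A a j *: b j) =
  \sum_(f : {ffun 'I_k -> 'I_d}) (\prod_a A a (f a)) *: alt (b \o f).
Proof.
under [RHS]eq_bigr do rewrite scaler_sumr.
rewrite exchange_big; apply: eq_bigr => s _ /=.
rewrite (@tprod_expand _ _ _ (fun a => A (s a))) scaler_sumr.
pose h (f : {ffun 'I_k -> 'I_d}) := [ffun a => f (s a)].
rewrite (reindex h); last first.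
  exists (fun f : {ffun 'I_k -> 'I_d} => [ffun a => f ((s^-1)%g a)]) => f _;
    by apply/ffunP => a; rewrite !ffunE ?permK ?permKV.
apply: eq_bigr => f _; rewrite !scalerA mulrC; congr (_ * _ *: _).
  rewrite [RHS](reindex_inj (@perm_inj _ s)) /=.
  by apply: eq_bigr => a _; rewrite ffunE.
by apply: eq_tprod => a /=; rewrite ffunE.
Qed.

(** Expanding every vector on a basis writes [alt v] as a combination of the
    spanning family; hence [wedge], defined through a projection, really is
    [alt]. *)
Lemma alt_ext_sub V k (v : 'I_k -> V) : alt v \in ext_sub k V.
Proof.
pose c a (j : 'I_(\dim {:V})) := coord (vbasis {:V}) j (v a).
rewrite (@eq_alt _ _ _ (fun a => \sum_j c a j *: (vbasis {:V})`_j)); last first.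
  by move=> a; apply: coord_vbasis; rewrite memvf.
rewrite (alt_expand c (fun j => (vbasis {:V})`_j)).
apply: memv_suml => f _; apply: memvZ; apply: memv_span.
by apply/codomP; exists f.
Qed.

Lemma vsval_wedge V k (v : 'I_k -> V) : vsval (wedge v) = alt v.
Proof. exact/vsprojK/alt_ext_sub. Qed.

Lemma eq_wedge V k (v v' : 'I_k -> V) : v =1 v' -> wedge v = wedge v'.
Proof. by move=> vv'; rewrite /wedge (eq_alt vv'). Qed.

Lemma wedge_scale V k (v : 'I_k -> V) (c : K) :
  wedge (fun a => c *: v a) = c ^+ k *: wedge v.
Proof.
rewrite /wedge -linearZ; congr (vsproj _ _).
apply: teval_inj => l; rewrite tevalZ !teval_alt -detZ; congr (\det _).
by apply/matrixP => a b; rewrite !mxE linearZ.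
Qed.

Lemma ext_mapE V W (f : 'Hom(V, W)) k (t : ext k V) :
  ext_map f k t = vsproj (ext_sub k W) (tpow_map f k (vsval t)).
Proof. by rewrite linfunE // => a t1 t2; rewrite !linearP. Qed.

Lemma ext_map_wedge V W (f : 'Hom(V, W)) k (v : 'I_k -> V) :
  ext_map f k (wedge v) = wedge (f \o v).
Proof. by rewrite ext_mapE vsval_wedge tpow_map_alt. Qed.

Lemma teval_pure2 V (u v : V) (l : 'I_2 -> dual V) :
  teval (pure2 u v) l = (l ord0 u : K) * l (lift ord0 ord0) v.
Proof. by rewrite /= !pureE scale_lfunE pureE /GRing.scale /= mulr1. Qed.

Lemma tpow_map_pure2 V W (f : 'Hom(V, W)) (u v : V) :
  tpow_map f 2 (pure2 u v) = pure2 (f u) (f v).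
Proof.
by apply: teval_inj => l; rewrite teval_tpow_map !teval_pure2 !comp_lfunE.
Qed.

Lemma pure2_scale V (c : K) (u : V) :
  pure2 (c *: u) (c *: u) = c ^+ 2 *: pure2 u u.
Proof.
apply: teval_inj => l; rewrite tevalZ !teval_pure2 !linearZ /=.
by rewrite mulrACA expr2.
Qed.

(** Multiplication by a tensor of degree 2 is all that [half_pow] uses; the two
    inclusions of indices are those of 2 and m in 2 + m. *)
Lemma tmul2E V m (s : tpow V 2) (t : tpow V m) l :
  teval (@tmul _ V 2 m s t : tpow V m.+2) l =
  teval s (fun i => l (lshift m i)) *
  teval t (fun i => l (rshift 2 i)).
Proof.
have lin0 (c : tpow V 1) : linear (fun f : dual V =>
    tmul ((c : tens V (tpow V 0)) f) t).
  by move=> a f f'; rewrite linearP /= scalerDl -scalerA.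
have lin1 (c : tpow V 2) : linear (fun f : dual V =>
    tmul ((c : tens V (tpow V 1)) f) t : tpow V m.+1).
  move=> a f f'; rewrite linearP /=; apply/lfunP => g.
  rewrite tensP !(linfunE (lin0 _)) tensP /=.
  by rewrite scalerDl -scalerA.
have -> : teval (@tmul _ V 2 m s t : tpow V m.+2) l =
    teval ((((s : tens _ _) (l ord0) : tens _ _) (l (lift ord0 ord0)) : K)
            *: t) (fun i => l (lift ord0 (lift ord0 i))).
  by rewrite [LHS]/= (linfunE (lin1 s)) (linfunE (lin0 _)).
rewrite tevalZ; congr (_ * _).
  by rewrite /=; congr ((s _ : 'Hom(_, _)) _); congr (l _); apply: val_inj.
by apply: eq_teval => i; congr (l _); apply: val_inj.
Qed.

Lemma teval_half_pow V (s : tpow V 2) m l :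
  teval (half_pow s m.+2) l =
  teval s (fun i => l (lshift m i)) *
  teval (half_pow s m) (fun i => l (rshift 2 i)).
Proof. exact: tmul2E. Qed.

Lemma tpow_map_half_pow V W (f : 'Hom(V, W)) (s : tpow V 2) m :
  tpow_map f m (half_pow s m) = half_pow (tpow_map f 2 s) m.
Proof.
suff: forall l, teval (tpow_map f m (half_pow s m)) l =
  teval (half_pow (tpow_map f 2 s) m) l by move/teval_inj.
(* Strong induction, since [half_pow] descends by steps of 2. *)
elim: m {-2}m (leqnn m) => [|N IH] [|[|m]] // lemN l.
- by rewrite teval_tpow_map.
- by rewrite teval_tpow_map.
- by rewrite teval_tpow_map [LHS]teval0 [RHS]teval0.
rewrite teval_tpow_map !teval_half_pow -!teval_tpow_map.
by rewrite IH // ltnW.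
Qed.

Lemma half_pow_scale V (c : K) (s : tpow V 2) m :
  half_pow (c *: s) m = c ^+ m./2 *: half_pow s m.
Proof.
suff: forall l, teval (half_pow (c *: s) m) l =
  teval (c ^+ m./2 *: half_pow s m) l by move/teval_inj.
elim: m {-2}m (leqnn m) => [|N IH] [|[|m]] // lemN l.
- by rewrite expr0 scale1r.
- by rewrite expr0 scale1r.
- by have z s' : @half_pow K V s' 1 = 0 by []; rewrite !z scaler0.
rewrite tevalZ !teval_half_pow tevalZ IH; last exact: ltnW.
by rewrite tevalZ /= exprS; ring.
Qed.

(** A nonzero tensor has a nonzero value on some family of functionals, and the
    concatenation of such families detects the product. *)
Lemma half_pow_neq0 V (s : tpow V 2) m : ~~ odd m -> s != 0 -> half_pow s m != 0.
Proof.
move=> me s0.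
have [l sl] : exists l, teval s l != 0.
  apply: contrapT => /forallNP no; case/eqP: s0; apply: teval_inj => l.
  by rewrite teval0; apply/eqP/negPn/negP/no.
suff [l' tl'] : exists l', teval (half_pow s m) l' != 0.
  by apply: contraNneq tl' => ->; rewrite teval0.
elim: m {-2}m (leqnn m) me => [|N IH] [|[|m]] // lemN me.
- by exists (fun=> 0); exact: oner_neq0.
- by exists (fun=> 0); exact: oner_neq0.
have [|l' tl'] := IH m (ltnW lemN); first by rewrite /= negbK in me.
exists (fun i : 'I_(2 + m) =>
  match fintype.split i with inl j => l j | inr j => l' j end).
rewrite teval_half_pow mulf_neq0 //.
  rewrite (@eq_teval _ _ _ _ l) // => i.
  by rewrite -[lshift m i]/(unsplit (inl i)) unsplitK.
rewrite (@eq_teval _ _ _ _ l') // => i.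
by rewrite -[rshift 2 i]/(unsplit (inr i)) unsplitK.
Qed.

Lemma half_pow_sym2 V (s : tpow V 2) m :
  ~~ odd m -> s \in sym2 V -> half_pow s m \in sym2_pow V m.
Proof.
move=> me sS; elim: m {-2}m (leqnn m) me => [|N IH] [|[|m]] // lemN me.
- by rewrite memvf.
- by rewrite memvf.
have tS : half_pow s m \in sym2_pow V m by apply: IH; [exact: ltnW|rewrite /= negbK in me].
have -> : half_pow s m.+2 =
    \sum_i \sum_j (coord (vbasis (sym2 V)) i s
       * coord (vbasis (sym2_pow V m)) j (half_pow s m)) *:
     (@tmul _ V 2 m (vbasis (sym2 V))`_i (vbasis (sym2_pow V m))`_j : tpow V m.+2).
  apply: teval_inj => l; rewrite teval_half_pow.
  rewrite {1}(coord_vbasis sS) {1}(coord_vbasis tS) !teval_sum mulr_suml.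
  apply: eq_bigr => i _; rewrite mulr_sumr teval_sum; apply: eq_bigr => j _.
  by rewrite !tevalZ [in RHS]tmul2E mulrACA.
apply: memv_suml => i _; apply: memv_suml => j _; apply: memvZ; apply: memv_span.
by apply/allpairsP; exists ((vbasis (sym2 V))`_i, (vbasis (sym2_pow V m))`_j);
   split=> //=; apply: mem_nth; rewrite size_tuple.
Qed.

(** Polarization: u ⊗ u is half of the symmetrization of its expansion on a
    basis, whence the condition on the characteristic. *)
Lemma pure2_sym2 V (u : V) : 2%:R != 0 :> K -> pure2 u u \in sym2 V.
Proof.
move=> two; pose c i := coord (vbasis {:V}) i u; pose b i := (vbasis {:V})`_i.
have -> : pure2 u u = \sum_i \sum_j (2^-1 * (c i * c j)) *:
   (pure2 (b i) (b j) + pure2 (b j) (b i)).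
  apply: teval_inj => l; rewrite teval_pure2.
  pose S := \sum_i \sum_j c i * c j * ((l ord0 (b i) : K) * l (lift ord0 ord0) (b j)).
  have -> : (l ord0 u : K) * l (lift ord0 ord0) u = S.
    rewrite (coord_vbasis (memvf u)) !linear_sum mulr_suml; apply: eq_bigr => i _.
    by rewrite mulr_sumr; apply: eq_bigr => j _; rewrite !linearZ /= mulrACA.
  transitivity (2^-1 * (S + S)); first by rewrite -mulr2n -[S *+ 2]mulr_natl mulrA mulVf ?mul1r.
  rewrite {2}/S exchange_big -big_split mulr_sumr teval_sum; apply: eq_bigr => i _.
  rewrite -big_split mulr_sumr teval_sum; apply: eq_bigr => j _.
  by rewrite tevalZ tevalD !teval_pure2 [LHS]/=; ring.
apply: memv_suml => i _; apply: memv_suml => j _; apply: memvZ; apply: memv_span.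
by apply/allpairsP; exists (b i, b j); split=> //=; apply: mem_nth; rewrite size_tuple.
Qed.

Definition wedge_set V n p (e : 'I_n -> V) (I : {set 'I_n}) : ext p V :=
  wedge (fun a : 'I_p => [seq e i | i <- enum I]`_a).

(** For an arbitrary family e, not only an orthonormal one, so that it can be
    transported along linear maps, from E_x to L_x ⊗ E_x = Ω^1_x. *)
Definition sum_squares V n p (e : 'I_n -> V) : tpow (ext p V) 2 :=
  \sum_(I : {set 'I_n} | #|I| == p) pure2 (wedge_set p e I) (wedge_set p e I).

(** An injective map h from p to n factors uniquely as a permutation of p
    followed by the increasing enumeration of its image. *)
Lemma sum_injections (M : nmodType) n p (i0 : 'I_n) (F : {ffun 'I_p -> 'I_n} -> M) :
  (forall h : {ffun 'I_p -> 'I_n}, ~~ injectiveb h -> F h = 0) ->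
  \sum_h F h =
  \sum_(I : {set 'I_n} | #|I| == p)
     \sum_(s : 'S_p) F [ffun a => nth i0 (enum I) (s a)].
Proof.
move=> F0; rewrite (bigID (fun h : {ffun _} => injectiveb h)) /=.
rewrite [X in _ + X]big1 ?addr0 //.
rewrite (partition_big (fun h : {ffun 'I_p -> 'I_n} => h @: [set: 'I_p])
           (fun I => #|I| == p)) /=; last first.
  by move=> h /injectiveP hi; rewrite card_imset // cardsT card_ord.
apply: eq_bigr => I /eqP cI.
have szI (a : 'I_p) : (a < size (enum I))%N by rewrite -cardE cI.
pose f (s : 'S_p) := [ffun a => nth i0 (enum I) (s a)].
have f_inj : injective f.
  move=> s s' /ffunP ss'; apply/permP => a; have := ss' a; rewrite !ffunE.
  by move/eqP; rewrite nth_uniq ?enum_uniq // => /eqP/val_inj.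
transitivity (\sum_(s in [set: 'S_p]) F (f s)); last first.
  by apply: eq_bigl => s; rewrite inE.
rewrite -[RHS](big_imset F (in2W f_inj)) /=.
apply: eq_bigl => h; apply/andP/imsetP => [[/injectiveP hi /eqP hI]|[s _ ->]].
  have hin a : h a \in enum I by rewrite mem_enum -hI imset_f.
  have hlt a : (index (h a) (enum I) < p)%N by rewrite -[X in (_ < X)%N]cI cardE index_mem.
  pose r a := Ordinal (hlt a).
  have r_inj : injective r.
    by move=> a b [] /(congr1 (nth i0 (enum I))); rewrite !nth_index // => /hi.
  exists (perm r_inj); first by rewrite inE.
  apply/ffunP => a.
  by rewrite ffunE permE /= nth_index.
have fi : injective (f s).
  move=> a b /eqP; rewrite !ffunE nth_uniq ?enum_uniq // => /eqP/val_inj.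
  exact: perm_inj.
split; first exact/injectiveP.
rewrite eqEcard card_imset // cardsT card_ord cI leqnn andbT.
by apply/fintype.subsetP => _ /imsetP[a _ ->]; rewrite ffunE -mem_enum mem_nth.
Qed.

(** In e_I ⊗ e_I the permutations that define the first factor may be moved to
    the second one, where they are absorbed by the antisymmetry of [alt]. The
    sum over subsets becomes a sum over all maps h, because those that are not
    injective give zero. No factor p! appears, and the right-hand side is
    multilinear in e. *)
Lemma sum_squaresE V n p (e : 'I_n -> V) (phi psi : 'Hom(tpow V p, K^o)) : (0 < n)%N ->
  \sum_(I : {set 'I_n} | #|I| == p)
     (phi (vsval (wedge_set p e I)) : K) * psi (vsval (wedge_set p e I)) =
  \sum_(h : {ffun 'I_p -> 'I_n}) phi (tprod (e \o h)) * psi (alt (e \o h)).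
Proof.
move=> n0; pose i0 := Ordinal n0.
rewrite (@sum_injections _ _ _ i0); last first.
  move=> h /injectivePn[a [b ab hab]]; rewrite (@alt_repeat _ _ _ a b) //=.
    by rewrite linear0 mulr0.
  by rewrite hab.
apply: eq_bigr => I /eqP cI; rewrite vsval_wedge.
pose v (a : 'I_p) := e (nth i0 (enum I) a).
rewrite (@eq_alt _ _ _ v); last first.
  by move=> a; rewrite (nth_map i0) // -cardE cI.
rewrite {1}/alt linear_sum mulr_suml; apply: eq_bigr => s _.
have hv : e \o [ffun a => nth i0 (enum I) (s a)] =1 v \o s.
  by move=> a /=; rewrite ffunE.
rewrite (eq_alt hv) (eq_tprod hv).
by rewrite alt_perm !linearZ /= /GRing.scale /= mulrA [_ * phi _]mulrC.
Qed.

(** The sum of the squares of the e_I depends only on the quadratic form: once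
    it is a sum over all maps, each of the p indices is contracted separately,
    and each contraction is an entry of A^T A. *)
Lemma sum_squares_orthogonal V n p (e e' : 'I_n -> V) (A : 'M[K]_n) :
  (0 < n)%N -> A^T *m A = 1%:M -> (forall i, e' i = \sum_j A i j *: e j) ->
  sum_squares p e' = sum_squares p e.
Proof.
move=> n0 A1 e'E; apply: teval_inj => l.
pose phi i : 'Hom(tpow V p, K^o) := ((l i : 'Hom(_, _)) \o linfun (vsproj (ext_sub p V)))%VF.
have phiE i (t : ext p V) : l i t = phi i (vsval t).
  by rewrite comp_lfunE lfunE /= vsvalK.
have sqE (d : 'I_n -> V) : teval (sum_squares p d) l =
    \sum_(h : {ffun 'I_p -> 'I_n}) (phi ord0 (tprod (d \o h)) : K) *
        phi (lift ord0 ord0) (alt (d \o h)).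
  rewrite -sum_squaresE // teval_sum; apply: eq_bigr => I _.
  by rewrite teval_pure2 !phiE.
rewrite !sqE.
have expand (h : {ffun 'I_p -> 'I_n}) : e' \o h =1 fun a => \sum_j A (h a) j *: e j.
  by move=> a /=.
under eq_bigr => h _ do rewrite (eq_tprod (expand h)) (eq_alt (expand h))
  (@tprod_expand _ _ _ (fun a => A (h a))) (@alt_expand _ _ _ (fun a => A (h a)))
  !linear_sum mulr_suml.
rewrite exchange_big; apply: eq_bigr => k _ /=.
under eq_bigr do rewrite mulr_sumr.
rewrite exchange_big /=.
(* The product of p sums is a sum over maps; each factor is (A^T A)_{k a, k' a}. *)
have coef (k' : {ffun 'I_p -> 'I_n}) : \sum_(h : {ffun 'I_p -> 'I_n})
    (\prod_a A (h a) (k a)) * (\prod_a A (h a) (k' a)) = (k == k')%:R.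
  under eq_bigr do rewrite -big_split /=.
  rewrite -(bigA_distr_bigA (fun a i => A i (k a) * A i (k' a))) /=.
  have Aij (a : 'I_p) : \sum_i A i (k a) * A i (k' a) = (k a == k' a)%:R.
    have := congr1 (fun M : 'M[K]_n => M (k a) (k' a)) A1; rewrite !mxE => <-.
    by apply: eq_bigr => i _; rewrite mxE.
  under eq_bigr do rewrite Aij.
  have [<-|kk'] := eqVneq k k'; first by rewrite big1 // => a _; rewrite eqxx.
  have [a kka] : exists a, k a != k' a.
    apply: contrapT => /forallNP no; case/eqP: kk'; apply/ffunP => a.
    exact/eqP/negPn/negP/no.
  by rewrite (bigD1 a) //= (negPf kka) mul0r.
transitivity (\sum_k' (k == k')%:R *
    ((phi ord0 (tprod (e \o k)) : K) * phi (lift ord0 ord0) (alt (e \o k')))).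
  apply: eq_bigr => k' _; rewrite -coef mulr_suml; apply: eq_bigr => h _.
  by rewrite !linearZ /= mulrACA.
rewrite (bigD1 k) //= eqxx mul1r big1 ?addr0 // => k' kk'.
by rewrite eq_sym (negPf kk') mul0r.
Qed.

(** Linearity makes this hold beyond the end of the sequence, where both sides
    take the default value 0. *)
Lemma nth_map_linear V W (f : {linear V -> W}) n (e : 'I_n -> V) (r : seq 'I_n) a :
  [seq f (e i) | i <- r]`_a = f [seq e i | i <- r]`_a.
Proof.
elim: r a => [|i r IH] [|a] //=; by rewrite linear0.
Qed.

Lemma sum_squares_map V W (f : 'Hom(V, W)) n p (e : 'I_n -> V) :
  tpow_map (ext_map f p) 2 (sum_squares p e) = sum_squares p (f \o e).
Proof.
rewrite /sum_squares linear_sum; apply: eq_bigr => I _.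
rewrite [LHS]tpow_map_pure2 ext_map_wedge.
have -> // : wedge (f \o (fun a : 'I_p => [seq e i | i <- enum I]`_a)) =
  wedge_set p (f \o e) I.
by apply: eq_wedge => a /=; rewrite -nth_map_linear.
Qed.

Lemma sum_squares_scale V n p (c : K) (e : 'I_n -> V) :
  sum_squares p (fun i => c *: e i) = c ^+ (2 * p) *: sum_squares p e.
Proof.
rewrite /sum_squares scaler_sumr; apply: eq_bigr => I _.
rewrite mulnC exprM -pure2_scale -wedge_scale.
have -> // : wedge_set p (fun i => c *: e i) I =
  wedge (fun a : 'I_p => c *: [seq e i | i <- enum I]`_a).
by apply: eq_wedge => a; rewrite -(nth_map_linear ( *:%R c : {linear V -> V})).
Qed.

Lemma eq_sum_squares V n p (e e' : 'I_n -> V) :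
  e =1 e' -> sum_squares p e = sum_squares p e'.
Proof. by move=> /funext ->. Qed.

(** Functionals l dual to e give a functional on the exterior power that
    evaluates e_I to a minor of the identity matrix, hence to 1 for one chosen
    subset J and to 0 for the others. *)
Lemma sum_squares_neq0 V n p (e : 'I_n -> V) (l : 'I_n -> dual V) :
  (0 < n)%N -> (p <= n)%N -> (forall i j, l j (e i) = (i == j)%:R :> K) ->
  sum_squares p e != 0.
Proof.
move=> n0 pn le; pose i0 := Ordinal n0.
have [J cJ] : exists J : {set 'I_n}, #|J| == p.
  have : (0 < #|[set A : {set 'I_n} | #|A| == p]|)%N.
    by rewrite card_draws card_ord bin_gt0.
  by case/card_gt0P => J; rewrite inE; exists J.
pose enum_at (I : {set 'I_n}) (a : 'I_p) := nth i0 (enum I) a.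
have szJ (I : {set 'I_n}) (a : 'I_p) : #|I| == p -> (a < size (enum I))%N.
  by move=> /eqP cI; rewrite -cardE cI.
pose f (t : ext p V) : K^o := teval (vsval t) (fun a => l (enum_at J a)).
have lf : linear f by move=> c t t'; rewrite /f linearP; exact: teval_linear.
have fE (I : {set 'I_n}) : #|I| == p -> f (wedge_set p e I) = (I == J)%:R.
  move=> cI; rewrite /f vsval_wedge teval_alt.
  have -> : (\matrix_(a, b) ((l (enum_at J a) [seq e i | i <- enum I]`_b) : K)) =
      \matrix_(a < p, b < p) (enum_at I b == enum_at J a)%:R.
    by apply/matrixP => a b; rewrite !mxE (nth_map i0) ?le // szJ.
  have [->|IJ] := eqVneq I J.
    rewrite -[RHS](det1 _ p); congr (\det _); apply/matrixP => a b; rewrite !mxE.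
    by rewrite nth_uniq ?enum_uniq ?szJ // eq_sym.
  (* The row of the minor indexed by an element of J outside I is zero. *)
  have [j jJ jI] : exists2 j, j \in J & j \notin I.
    apply/fintype.subsetPn; apply: contra IJ => JI.
    by rewrite eq_sym eqEcard JI (eqP cI) (eqP cJ) leqnn.
  have jlt : (index j (enum J) < p)%N.
    by rewrite -[X in (_ < X)%N](eqP cJ) cardE index_mem mem_enum.
  pose a0 := Ordinal jlt.
  rewrite (expand_det_row _ a0) big1 // => b _; rewrite mxE.
  have -> : enum_at J a0 = j by rewrite /enum_at nth_index // mem_enum.
  case: eqP => [bj|_]; last by rewrite mul0r.
  by case/negP: jI; rewrite -bj -mem_enum mem_nth // szJ.
have f1 : teval (sum_squares p e) (fun=> linfun f) = 1.
  transitivity (\sum_(I : {set 'I_n} | #|I| == p) ((I == J)%:R * (I == J)%:R : K)).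
    rewrite teval_sum; apply: eq_bigr => I cI.
    by rewrite teval_pure2 !(linfunE lf) fE.
  rewrite (bigD1 J cJ) /= eqxx mulr1 big1 ?addr0 // => I /andP[_ IJ].
  by rewrite (negPf IJ) mul0r.
by apply/eqP => s0; move: f1; rewrite s0 teval0 => /eqP; rewrite eq_sym oner_eq0.
Qed.

Lemma sum_squares_sym2 V n p (e : 'I_n -> V) :
  2%:R != 0 :> K -> sum_squares p e \in sym2 (ext p V).
Proof. by move=> two; apply: memv_suml => I _; exact: pure2_sym2. Qed.

End TensorAlgebra.

(** * Symmetric bilinear forms and orthonormal families *)

Section OrthonormalTuples.
Variables (K : fieldType) (V : vectType K) (B : V -> V -> K).
Hypothesis BC : forall u v, B u v = B v u.
Hypothesis BP : forall a u v w, B w (a *: u + v) = a * B w u + B w v.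

Lemma bilin0 w : B w 0 = 0.
Proof. by apply: (addrI (B w 0)); rewrite -[X in X + _]mul1r -BP scaler0 !addr0. Qed.

Lemma bilinZ a u w : B w (a *: u) = a * B w u.
Proof. by rewrite -[a *: u]addr0 BP bilin0 addr0. Qed.

Lemma bilin_sum w n (c : 'I_n -> K) (e : 'I_n -> V) :
  B w (\sum_i c i *: e i) = \sum_i c i * B w (e i).
Proof.
by elim/big_rec2: _ => [|i y1 y2 _ <-]; rewrite ?bilin0 ?BP.
Qed.

Lemma orthonormal_is_basis n (e : n.-tuple V) : \dim {:V} = n ->
  (forall i j : 'I_n, B e`_i e`_j = (i == j)%:R) -> basis_of {:V} e.
Proof.
move=> dV ee; rewrite basisEfree subvf size_tuple dV leqnn !andbT.
apply/freeP => k k0 i.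
have := bilin_sum e`_i k (fun j : 'I_n => e`_j).
rewrite k0 (bigD1 i) //= ee eqxx mulr1 big1 ?addr0 => [<-|j ji].
  by rewrite bilin0.
by rewrite ee eq_sym (negPf ji) mulr0.
Qed.

Lemma orthonormal_expansion n (e : n.-tuple V) : basis_of {:V} e ->
  (forall i j : 'I_n, B e`_i e`_j = (i == j)%:R) ->
  forall u, u = \sum_(i < n) B u e`_i *: e`_i.
Proof.
move=> eb ee u; have uE := coord_basis eb (memvf u).
rewrite {1}uE; apply: eq_bigr => i _; congr (_ *: _).
rewrite {2}uE BC (bilin_sum _ (fun j => coord e j u) (fun j : 'I_n => e`_j)).
rewrite (bigD1 i) //= ee eqxx mulr1 big1 ?addr0 // => j ji.
by rewrite ee eq_sym (negPf ji) mulr0.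
Qed.

(** The coordinates of one orthonormal basis in another form an orthogonal
    matrix. *)
Lemma sum_squares_orthonormal n p (e e' : n.-tuple V) : (0 < n)%N ->
  basis_of {:V} e -> (forall i j : 'I_n, B e`_i e`_j = (i == j)%:R) ->
  (forall i j : 'I_n, B e'`_i e'`_j = (i == j)%:R) ->
  sum_squares p (fun i : 'I_n => e'`_i) = sum_squares p (fun i : 'I_n => e`_i).
Proof.
move=> n0 eb ee ee'.
pose A : 'M[K]_n := \matrix_(i, j) B e'`_i e`_j.
have expand (i : 'I_n) : e'`_i = \sum_j A i j *: e`_j.
  by rewrite {1}[e'`_i](orthonormal_expansion eb ee); apply: eq_bigr => j _; rewrite mxE.
apply: (sum_squares_orthogonal _ n0 _ expand); apply: mulmx1C.
apply/matrixP => i j; rewrite !mxE -ee' (expand j).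
rewrite (bilin_sum _ (A j) (fun j : 'I_n => e`_j)).
by apply: eq_bigr => k _; rewrite !mxE mulrC.
Qed.

(** The Gram matrix does not see multiples of an isotropic vector eta orthogonal
    to both arguments. This is what makes the local frame below orthonormal
    without any square root or matrix inversion. *)
Lemma transvection_isometry eta a b u v :
  B eta eta = 0 -> B u eta = 0 -> B v eta = 0 ->
  B (u - a *: eta) (v - b *: eta) = B u v.
Proof.
move=> ee ue ve; rewrite -!scaleNr ![_ + _ *: eta]addrC BP BC BP ee.
by rewrite (BC eta u) ue [B _ v]BC BP ve !(mulr0, add0r) BC.
Qed.

End OrthonormalTuples.


Lemma dim_cap_lker (K : fieldType) (V : vectType K) (U : {vspace V})
    (l : dual V) u : u \in U -> l u != 0 -> (\dim (U :&: lker l)).+1 = \dim U.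
Proof.
move=> uU lu; rewrite -(limg_ker_dim l U) -addn1; congr (_ + _)%N.
apply/eqP; rewrite eqn_leq andbC; apply/andP; split.
  by rewrite (leq_trans (dimvS (subvf _))) // dimvf.
rewrite lt0n dimv_eq0; apply: contraNneq lu => l0.
by rewrite -memv0 -l0 memv_img.
Qed.

Section OrthonormalFamilies.
Variables (K : numClosedFieldType) (V : vectType K) (B : V -> V -> K).
Hypothesis BC : forall u v, B u v = B v u.
Hypothesis BP : forall a u v w, B w (a *: u + v) = a * B w u + B w v.

(** Gram-Schmidt over an algebraically closed field. A nondegenerate form has an
    anisotropic vector v by polarization; after scaling B(v, v) = 1, the form
    stays nondegenerate on the orthogonal of v. *)
Lemma exists_orthonormal_family d (U : {vspace V}) : \dim U = d ->
  (forall u, u \in U -> (forall v, v \in U -> B u v = 0) -> u = 0) ->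
  exists e : 'I_d -> V,
    (forall i, e i \in U) /\ forall i j, B (e i) (e j) = (i == j)%:R.
Proof.
have BD u v w : B w (u + v) = B w u + B w v.
  by rewrite -[u]scale1r BP mul1r scale1r.
elim: d U => [|d IH] U dU nondeg.
  by exists (fun=> 0); split=> [i|[]//]; rewrite mem0v.
have [v0 v0U v0v0] : exists2 v, v \in U & B v v != 0.
  apply: contrapT => no.
  have iso v : v \in U -> B v v = 0.
    by move=> vU; apply/eqP/negPn/negP => vv; apply: no; exists v.
  suff U0 : U = 0%VS by move: dU; rewrite U0 dimv0.
  apply/eqP; rewrite -subv0; apply/subvP => u uU; rewrite memv0; apply/eqP.
  apply: nondeg => // v vU; have := iso _ (memvD uU vU).
  rewrite BD ![B (u + v) _]BC !BD !iso // add0r addr0 (BC v u) -mulr2n => /eqP.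
  by rewrite mulrn_eq0 => /eqP.
pose v := (sqrtC (B v0 v0))^-1 *: v0.
have vU : v \in U by rewrite memvZ.
have vv : B v v = 1.
  by rewrite (bilinZ BP) BC (bilinZ BP) mulrA -expr2 exprVn sqrtCK mulVf.
have lin : linear (B v : V -> K^o) by move=> a u w; rewrite BP.
pose l : dual V := linfun (B v : V -> K^o).
have lE u : l u = B v u by rewrite (linfunE lin).
pose U' := (U :&: lker l)%VS.
have inU' u : (u \in U') = (u \in U) && (B v u == 0).
  by rewrite memv_cap memv_ker lE.
have [||e [eU' ee]] := IH U'.
- by apply: eq_add_S; rewrite (@dim_cap_lker _ _ U l v) // lE vv oner_neq0.
- move=> u; rewrite inU' => /andP[uU /eqP vu] uU'; apply: nondeg => // x xU.
  have -> : x = B v x *: v + (x - B v x *: v) by rewrite addrC subrK.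
  rewrite BP (BC u v) vu mulr0 add0r uU' // inU' memvB ?memvZ //=.
  by rewrite -scaleNr addrC BP vv mulr1 addNr.
exists (fun i => if unlift ord0 i is Some j then e j else v); split.
  move=> i; case: unliftP => [j _|_] //.
  by have := eU' j; rewrite inU' => /andP[].
have ve j : B v (e j) = 0 by have := eU' j; rewrite inU' => /andP[_ /eqP].
move=> i j; case: unliftP => [i' ->|->]; case: unliftP => [j' ->|->].
- by rewrite ee (inj_eq (@lift_inj _ ord0)).
- by rewrite BC ve eq_sym (negPf (neq_lift _ _)).
- by rewrite ve (negPf (neq_lift _ _)).
- by rewrite vv eqxx.
Qed.

Hypothesis B_nondeg : forall u, (forall v, B u v = 0) -> u = 0.

(** The hyperbolic plane spanned by w and eta is nondegenerate, so the whole
    space is its orthogonal direct sum with a nondegenerate space. *)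
Lemma exists_orthonormal_complement d w eta : \dim {:V} = d.+2 ->
  B w w = 0 -> B eta eta = 0 -> B w eta = 1 ->
  exists e : 'I_d -> V,
    (forall i, B (e i) eta = 0) /\ forall i j, B (e i) (e j) = (i == j)%:R.
Proof.
move=> dV ww etaeta weta.
have lin v : linear (B v : V -> K^o) by move=> a u u'; rewrite BP.
pose l v : dual V := linfun (B v : V -> K^o).
have lE v u : l v u = B v u by rewrite (linfunE (lin v)).
pose U := (fullv :&: lker (l w) :&: lker (l eta))%VS.
have inU u : (u \in U) = (B w u == 0) && (B eta u == 0).
  by rewrite !memv_cap memvf !memv_ker !lE.
have dU : \dim U = d.
  apply/eq_add_S/eq_add_S.
  rewrite (@dim_cap_lker _ _ _ (l eta) w) ?(@dim_cap_lker _ _ _ (l w) eta) ?memvf //.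
  - by rewrite lE weta oner_neq0.
  - by rewrite memv_cap memvf memv_ker lE ww eqxx.
  - by rewrite lE BC weta oner_neq0.
have [|e [eU ee]] := exists_orthonormal_family dU.
  move=> u; rewrite inU => /andP[/eqP wu /eqP eu] uU; apply: B_nondeg => v.
  (* x is the component of v orthogonal to the hyperbolic plane. *)
  pose x := (- B w v) *: eta + ((- B eta v) *: w + v).
  have -> : v = B w v *: eta + (B eta v *: w + x).
    by rewrite /x !scaleNr (addrCA (B eta v *: w)) !addNKr.
  have xU : x \in U.
    rewrite inU !BP ww weta etaeta (BC eta w) weta.
    by rewrite !mulr0 !mulr1 !add0r !addNr eqxx.
  clearbody x; by rewrite !BP (BC u eta) eu (BC u w) wu !mulr0 !add0r uU.
exists e; split => // i.
by have := eU i; rewrite inU => /andP[_ /eqP eei]; rewrite BC.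
Qed.

End OrthonormalFamilies.


(** * One-dimensional spaces, subspaces and quotients *)

Section Lines.
Variables (K : fieldType) (V : vectType K) (w : V) (l : dual V).
Hypotheses (dV : \dim {:V} = 1%N) (lw : l w = 1).

Lemma dual_gen_neq0 : w != 0.
Proof.
have := oner_neq0 K; rewrite -[X in X != _ -> _]lw.
by apply: contraNneq => ->; rewrite linear0.
Qed.

Lemma line_gen v : v = l v *: w.
Proof.
have /eqP full : <[w]>%VS == fullv by rewrite eqEdim subvf dim_vline dual_gen_neq0 dV.
have : v \in <[w]>%VS by rewrite full memvf.
by case/vlineP => a ->; rewrite linearZ /= lw /GRing.scale /= mulr1.
Qed.

(** On a line every functional is a multiple of l, so a tensor power of a line
    has the single coordinate [teval t (fun=> l)]. *)
Lemma teval_line k (t : tpow V k) (l' : 'I_k -> dual V) :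
  teval t l' = (\prod_a (l' a w : K)) * teval t (fun=> l).
Proof.
rewrite -teval_scale; apply: eq_teval => a; apply/lfunP => v.
by rewrite scale_lfunE {1}(line_gen v) linearZ /= /GRing.scale /= mulrC.
Qed.

Lemma teval_line_eq0 k (t : tpow V k) : teval t (fun=> l) = 0 -> t = 0.
Proof. by move=> t0; apply: teval_inj => l'; rewrite teval_line t0 mulr0 teval0. Qed.

End Lines.

Lemma exists_dual (K : fieldType) (V : vectType K) (w : V) :
  \dim {:V} = 1%N -> w != 0 -> exists l : dual V, l w = 1.
Proof.
move=> dV w0; have /eqP full : <[w]>%VS == fullv.
  by rewrite eqEdim subvf dim_vline w0 dV.
pose b := [tuple w].
have bb : basis_of {:V} b.
  by rewrite basisEfree subvf dV leqnn !andbT seq1_free.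
exists (linfun (coord b ord0 : V -> K^o)); rewrite linfunE; last exact: linearP.
by have := coord_free ord0 ord0 (basis_free bb); rewrite eqxx.
Qed.


Lemma dim_subvs (K : fieldType) (V : vectType K) (U : {vspace V}) :
  \dim {:subvs_of U} = \dim U.
Proof. by rewrite dimvf. Qed.

Lemma dim_vquot_preim (K : fieldType) (V : vectType K) (U W : {vspace V}) :
  (W <= U)%VS ->
  \dim {:vquot (linfun (vsval : subvs_of U -> V) @^-1: W)%VS} =
  (\dim U - \dim W)%N.
Proof.
move=> WU; rewrite dim_subvs dimv_compl dim_subvs; congr (_ - _)%N.
set f := linfun _.
have fI : lker f = 0%VS.
  by apply/eqP/lker0P => u v; rewrite !lfunE => /val_inj.
rewrite -(@limg_dim_eq _ _ _ f) ?fI ?capv0 // lpreimK //.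
apply/subvP => v vW; have vU := subvP WU v vW.
by rewrite -(vsprojK vU) -[vsval _](lfunE vsval) memv_img ?memvf.
Qed.

(** The map w ⊗ e of [theta], for abstract spaces. *)
Lemma pairing_homE (K : fieldType) (V W : vectType K) (B : V -> V -> K) (w : W) :
  (forall u v, B u v = B v u) ->
  (forall a u v w', B w' (a *: u + v) = a * B w' u + B w' v) ->
  forall e (phi : 'Hom(W, V)),
  (linfun (fun e' : V => linfun (fun psi : 'Hom(W, V) => B e' (psi w) : K^o)
     : dual 'Hom(W, V)) e : 'Hom(_, _)) phi = B e (phi w).
Proof.
move=> BC BP e phi.
have lin e' : linear (fun psi : 'Hom(W, V) => B e' (psi w) : K^o).
  by move=> a p q; rewrite add_lfunE scale_lfunE; exact: BP.
rewrite linfunE ?(linfunE (lin _)) // => a e1 e2; apply/lfunP => q.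
rewrite add_lfunE scale_lfunE !(linfunE (lin _)).
by rewrite BC BP ![B (q w) _]BC.
Qed.


(** * Geometry of the points of the domain *)

Section Geometry.
Variables (R : realType) (n : nat) (L : lattice n.+2).
Local Notation C := R[i].
Local Notation V := 'cV[C]_n.+2.
Variable D : set (projsp R[i] n.+2).

Local Notation form := (@form R n L).

Lemma form_linear w : linear (form w : V -> C^o).
Proof. by move=> a u v; rewrite formDr formZr. Qed.

Lemma formP a u v w : form w (a *: u + v) = a * form w u + form w v.
Proof. by rewrite formDr formZr. Qed.

Lemma form_nondeg u : (forall v, form u v = 0) -> u = 0.
Proof.
move=> u0; have gu : gram_in C L \in unitmx.
  by rewrite unitmxE unitfE det_map_mx intr_eq0 gram_nondeg.
have : u^T *m gram_in C L = 0.
  apply/rowP => j; have := u0 (delta_mx j ord0).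
  by rewrite /Defs.form -colE !mxE.
move=> /(congr1 (mulmx^~ (invmx (gram_in C L)))).
by rewrite mulmxK // mul0mx => /(congr1 trmx); rewrite trmxK trmx0.
Qed.

Lemma form_conj u v : form (conjv u) (conjv v) = (form u v)^*%C.
Proof.
rewrite /Defs.form /conjv. rewrite map_trmx.
have {1}-> : gram_in C L = map_mx (@conjc R) (gram_in C L).
  by apply/matrixP => i j; rewrite !mxE rmorph_int.
by rewrite -!map_mxM mxE.
Qed.

Lemma line_neq0 (x : D) : line x != 0%VS.
Proof. by rewrite -dimv_eq0 (eqP (valP (val x))). Qed.

Lemma line_vpick (x : D) : vpick (line x) \in line x /\ vpick (line x) != 0.
Proof. by rewrite memv_pick vpick0 line_neq0. Qed.

Lemma lineE (x : D) w : w \in line x -> w != 0 -> line x = <[w]>%VS.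
Proof.
move=> wx w0; apply/esym/eqP; rewrite eqEdim -memvE wx dim_vline w0.
by rewrite (eqP (valP (val x))).
Qed.

Hypothesis D_Dpm : forall x, D x -> Dpm L x.

Lemma line_isotropic (x : D) u v : u \in line x -> v \in line x -> form u v = 0.
Proof.
have [px p0] := line_vpick x.
rewrite (lineE px p0) => /vlineP[a ->] /vlineP[b ->].
have [q _] := D_Dpm (set_mem (valP x)).
by rewrite formZl formZr (q _ px) !mulr0.
Qed.

(** For w in x, the conjugate of w is isotropic because the form is real, and
    pairs to a positive number with w because x lies in the domain; eta is its
    multiple with (w, eta) = 1. The e_i are an orthonormal basis of the
    orthogonal of w and eta, which represents E_x. *)
Lemma adapted_frame (x : D) : exists w eta (e : 'I_n -> V),
  [/\ w \in line x, form w eta = 1, form eta eta = 0,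
      forall i, form (e i) eta = 0 &
      forall i j, form (e i) (e j) = (i == j)%:R].
Proof.
have [wx w0] := line_vpick x; set w := vpick _ in wx w0.
have [_ /(_ w wx w0) pos] := D_Dpm (set_mem (valP x)).
have ww : form w w = 0 by exact: (line_isotropic wx wx).
pose eta := (form w (conjv w))^-1 *: conjv w.
have weta : form w eta = 1 by rewrite formZr mulVf // lt0r_neq0.
have etaeta : form eta eta = 0.
  by rewrite formZr formZl form_conj ww conjc0 !mulr0.
exists w, eta.
have dV : \dim {:V} = n.+2 by rewrite dimvf /dim /= muln1.
have [e [eeta ee]] := exists_orthonormal_complement (@formC R n L) formP
  form_nondeg dV ww etaeta weta.
by exists e.
Qed.

End Geometry.

Section Fibres.
Variables (R : realType) (n : nat) (L : lattice n.+2).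
Local Notation C := R[i].
Local Notation V := 'cV[C]_n.+2.
Variable D : set (projsp R[i] n.+2).
Local Notation form := (@form R n L).
Local Notation calE := (calE L D).
Local Notation calL := (calL L D).
Local Notation formE := (@formE R n L D).
Hypothesis D_Dpm : forall x, D x -> Dpm L x.

Lemma formEC x (u v : calE x) : formE u v = formE v u.
Proof. exact: formC. Qed.

Lemma formEP x a (u v w : calE x) : formE w (a *: u + v) = a * formE w u + formE w v.
Proof.
have lin : vsval (vlift (a *: u + v)) = a *: vsval (vlift u) + vsval (vlift v).
  by rewrite /vlift !linearP.
by rewrite /Defs.formE lin formP.
Qed.

Lemma orthv_line (x : D) w : w \in line x -> w != 0 ->
  orthv L (line x) = lker (linfun (form w : V -> C^o) : dual V).
Proof.
move=> wx w0; apply/vspaceP => v.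
rewrite [RHS]memv_ker (linfunE (form_linear L w)).
apply/idP/eqP => [/orthvP -> //|wv]; apply/orthvP => u; rewrite (lineE wx w0) => /vlineP[a ->].
by rewrite formZl wv mulr0.
Qed.

Lemma dim_orthv_line (x : D) : (\dim (orthv L (line x)) = n.+1)%N.
Proof.
have [w [eta [e [wx weta _ _ _]]]] := adapted_frame D_Dpm x.
have w0 : w != 0.
  by apply: contra_eq_neq weta => ->; rewrite -(scale0r 0) formZl mul0r eq_sym oner_neq0.
rewrite (orthv_line wx w0) -[lker _]capfv.
apply: eq_add_S; rewrite (@dim_cap_lker _ _ _ _ eta) ?memvf //.
  by rewrite dimvf /dim /= muln1.
by rewrite (linfunE (form_linear L w)) weta oner_neq0.
Qed.

Lemma dim_calE x : \dim {:calE x} = n.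
Proof.
rewrite dim_vquot_preim ?dim_orthv_line ?(eqP (valP (val x))) ?subn1 //.
apply/subvP => u ux; apply/orthvP => v vx; exact: (line_isotropic D_Dpm vx ux).
Qed.

Lemma thetaE x (w : calL x) (e : calE x) (phi : tangentB L D x) :
  (theta w e : 'Hom(_, _)) phi = formE e ((phi : 'Hom(calL x, calE x)) w).
Proof.
exact: (pairing_homE w (@formEC x) (@formEP x)).
Qed.

Lemma formE_orthonormal_basis x (e : n.-tuple (calE x)) :
  (forall i j : 'I_n, formE e`_i e`_j = (i == j)%:R) -> orthonormal_basis e.
Proof.
move=> ee; split=> //.
exact: (orthonormal_is_basis (@formEP x) (dim_calE x) ee).
Qed.

Lemma sum_eI2E p x (e : n.-tuple (calE x)) :
  sum_eI2 p e = sum_squares p (fun i : 'I_n => e`_i).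
Proof. by []. Qed.

Lemma sum_eI2_indep p x (e e' : n.-tuple (calE x)) : (0 < n)%N ->
  orthonormal_basis e -> orthonormal_basis e' -> sum_eI2 p e' = sum_eI2 p e.
Proof.
move=> n0 [eb ee] [_ ee']; rewrite !sum_eI2E.
exact: (sum_squares_orthonormal (@formEC x) (@formEP x) p n0 eb ee ee').
Qed.

Lemma iso_Omega2_sum_eI2 p x (w : calL x) (e : n.-tuple (calE x)) :
  iso_Omega2 p w (sum_eI2 p e) = sum_squares p (fun i : 'I_n => theta w e`_i).
Proof. by rewrite sum_eI2E; exact: sum_squares_map. Qed.

Lemma theta_scale x a (w : calL x) (e : calE x) :
  theta (a *: w) e = a *: theta w e.
Proof.
apply/lfunP => phi; rewrite scale_lfunE !thetaE.
have -> : (phi : 'Hom(calL x, calE x)) (a *: w) =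
    a *: (phi : 'Hom(calL x, calE x)) w by exact: linearZ.
exact: (bilinZ (@formEP x)).
Qed.

End Fibres.

(** * The local orthonormal frame *)

(** A vector eta and vectors e_i orthogonal to it give sections over all of D
    at once: the generator of the line y normalised by (., eta) = 1, and the
    classes of e_i - (e_i, w_y) eta. On the chart of the y not orthogonal to
    eta, these vectors lie in y^⊥ and have the Gram matrix of the e_i; they are
    visibly holomorphic in y. Outside the chart they take conventional
    values, as the inverse of 0 is 0. *)
Section Frame.
Variables (R : realType) (n : nat) (L : lattice n.+2).
Local Notation C := R[i].
Local Notation V := 'cV[C]_n.+2.
Variable D : set (projsp R[i] n.+2).
Local Notation form := (@form R n L).
Local Notation calE := (calE L D).
Local Notation calL := (calL L D).
Local Notation calLperp := (calLperp L D).
Local Notation formE := (@formE R n L D).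
Hypothesis D_Dpm : forall x, D x -> Dpm L x.

Lemma dim_calL x : \dim {:calL x} = 1%N.
Proof. by rewrite dim_subvs; exact/eqP/(valP (val x)). Qed.

Variables (eta : V) (e : 'I_n -> V).

Definition in_chart (y : D) := form (vpick (line y)) eta != 0.

Definition norm_gen (y : D) : V :=
  (form (vpick (line y)) eta)^-1 *: vpick (line y).

Definition gen_sec (y : D) : calL y := vsproj (line y) (norm_gen y).

Definition dual_sec (y : D) : dual (calL y) :=
  linfun (fun u : calL y => form eta (vsval u) : C^o).

Definition perp_vec i (y : D) : V := e i - form (e i) (norm_gen y) *: eta.

Definition perp_sec i (y : D) : calLperp y :=
  vsproj (orthv L (line y)) (perp_vec i y).

Definition frame_sec i (y : D) : calE y := vpi _ (perp_sec i y).

(** Any nonzero vector of the line y gives the same normalised generator; as a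
    function of v this formula is the holomorphic extension to the cone. *)
Lemma norm_genE (y : D) v : v \in line y -> form v eta != 0 ->
  in_chart y /\ norm_gen y = (form v eta)^-1 *: v.
Proof.
move=> vy veta; have [py p0] := line_vpick y.
have := vy; rewrite (lineE py p0) => /vlineP[a va].
move: veta; rewrite va formZl mulf_eq0 negb_or => /andP[a0 peta]; split=> //.
by rewrite invfM scalerA mulrAC mulVf // mul1r.
Qed.

Lemma norm_gen_line y : norm_gen y \in line y.
Proof. by rewrite memvZ // memv_pick. Qed.

Lemma vsval_gen_sec y : vsval (gen_sec y) = norm_gen y.
Proof. exact/vsprojK/norm_gen_line. Qed.

Lemma form_norm_gen y : in_chart y -> form eta (norm_gen y) = 1.
Proof. by move=> r; rewrite formZr (formC L eta) mulVf. Qed.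

Lemma dual_secE y u : dual_sec y u = form eta (vsval u).
Proof.
rewrite linfunE // => a u1 u2.
have -> : vsval (a *: u1 + u2) = a *: vsval u1 + vsval u2 by rewrite linearP.
exact: formP.
Qed.

Lemma dual_gen_sec y : in_chart y -> dual_sec y (gen_sec y) = 1.
Proof. by move=> r; rewrite dual_secE vsval_gen_sec form_norm_gen. Qed.

Hypotheses (etaeta : form eta eta = 0) (eeta : forall i, form (e i) eta = 0)
  (ee : forall i j, form (e i) (e j) = (i == j)%:R).

Lemma perp_vec_perp i y : in_chart y -> perp_vec i y \in orthv L (line y).
Proof.
move=> r; have [py p0] := line_vpick y; apply/orthvP => u.
have g0 : norm_gen y != 0 by rewrite scaler_eq0 invr_eq0 negb_or; apply/andP.
rewrite (lineE (norm_gen_line y) g0) => /vlineP[a ->].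
rewrite formZl /perp_vec formC -scaleNr formDl formZl form_norm_gen // mulr1 subrr.
by rewrite mulr0.
Qed.

Lemma vsval_perp_sec i y : in_chart y -> vsval (perp_sec i y) = perp_vec i y.
Proof. by move=> r; apply/vsprojK/perp_vec_perp. Qed.

Lemma frame_orthonormal i j y : in_chart y ->
  formE (frame_sec i y) (frame_sec j y) = (i == j)%:R.
Proof.
move=> r; have [q _] := D_Dpm (set_mem (valP y)).
transitivity (form (vsval (perp_sec i y)) (vsval (perp_sec j y))).
  exact: (formE_pi (perp_sec i y) (perp_sec j y) q).
transitivity (form (perp_vec i y) (perp_vec j y)).
  exact: (f_equal2 form (vsval_perp_sec i r) (vsval_perp_sec j r)).
rewrite -ee; exact: (transvection_isometry (@formC R n L) (@formP R n L)).
Qed.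

Definition frame_tuple y : n.-tuple (calE y) := [tuple frame_sec i y | i < n].

Lemma frame_tupleE y (i : 'I_n) : (frame_tuple y)`_i = frame_sec i y.
Proof. by rewrite nth_mktuple. Qed.

Lemma frame_basis y : in_chart y -> orthonormal_basis (frame_tuple y).
Proof.
move=> r; apply: formE_orthonormal_basis => // i j.
by rewrite !frame_tupleE frame_orthonormal.
Qed.

End Frame.

(** * The canonical map on one fibre *)

Section GenericMap.
Variables (K : fieldType) (V W : vectType K) (k : nat) (w : V) (l : dual V) (h : W).
Hypotheses (dV : \dim {:V} = 1%N) (lw : l w = 1).
Variable phi : 'Hom(tpow V k, W).
Hypothesis phiE : forall t, phi t = teval t (fun=> l) *: h.

Lemma limg_evaluation : limg phi = <[h]>%VS.
Proof.
apply/vspaceP => u; apply/memv_imgP/vlineP => [[t _ ->]|[c ->]].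
  by exists (teval t (fun=> l)).
exists (c *: tprod (fun=> w)); first exact: memvf.
by rewrite phiE tevalZ teval_tprod big1 ?mulr1.
Qed.

Lemma lker_evaluation : h != 0 -> lker phi = 0%VS.
Proof.
move=> h0; apply/eqP; rewrite -subv0; apply/subvP => t.
rewrite memv_ker phiE scaler_eq0 (negPf h0) orbF memv0 => /eqP t0.
by apply/eqP; apply: (teval_line_eq0 dV lw).
Qed.
End GenericMap.

(** T_w has weight 2p in w, so its power m/2 has the weight pm of L_x^{⊗pm}: this
    is why the map does not depend on the generator w. *)
Lemma half_pow_sum_squares_scale (K : fieldType) (V : vectType K) n p m
    (a : K) (e : 'I_n -> V) : ~~ odd m ->
  half_pow (sum_squares p (fun i => a *: e i)) m =
  a ^+ (p * m) *: half_pow (sum_squares p e) m.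
Proof.
move=> me; rewrite sum_squares_scale half_pow_scale -exprM.
by congr (_ ^+ _ *: _); rewrite -[in RHS](even_halfK me) -mul2n mulnCA mulnA.
Qed.

Lemma exists_frame (R : realType) (n : nat) (L : lattice n.+2)
    (D : set (projsp R[i] n.+2)) (D_Dpm : forall x, D x -> Dpm L x) (x : D) :
  exists (w : calL L D x) (l : dual (calL L D x)) (e : n.-tuple (calE L D x)),
    l w = 1 /\ orthonormal_basis e.
Proof.
have [v [eta [f [vx veta etaeta feta ff]]]] := adapted_frame D_Dpm x.
have [|r _] := norm_genE vx (_ : form L v eta != 0).
  by rewrite veta oner_neq0.
exists (gen_sec L eta x), (dual_sec L eta x), (frame_tuple L eta f x).
split; first exact: dual_gen_sec.
exact: (frame_basis D_Dpm etaeta feta ff r).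
Qed.

Section Pointwise.
Variables (R : realType) (n : nat) (L : lattice n.+2).
Local Notation C := R[i].
Variable D : set (projsp R[i] n.+2).
Local Notation calE := (calE L D).
Local Notation calL := (calL L D).
Hypothesis D_Dpm : forall x, D x -> Dpm L x.
Variables (p m : nat).
Hypotheses (p_gt0 : (0 < p)%N) (p_le_n : (p <= n)%N) (m_even : ~~ odd m).

Let n_gt0 : (0 < n)%N. Proof. exact: leq_trans p_le_n. Qed.

Definition image_gen x (w : calL x) (e : n.-tuple (calE x)) :
    tpow (Omega L D p x) m :=
  half_pow (iso_Omega2 p w (sum_eI2 p e)) m.

Lemma image_genE x (w : calL x) (e : n.-tuple (calE x)) :
  image_gen w e = half_pow (sum_squares p (fun i : 'I_n => theta w e`_i)) m.
Proof. by rewrite /image_gen iso_Omega2_sum_eI2. Qed.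

Lemma image_gen_scale x (a : C) (w : calL x) (e : n.-tuple (calE x)) :
  image_gen (a *: w) e = a ^+ (p * m) *: image_gen w e.
Proof.
rewrite (image_genE (a *: w) e) (image_genE w e).
rewrite (_ : (fun i : 'I_n => theta (a *: w) e`_i) =
             (fun i : 'I_n => a *: theta w e`_i)); last first.
  by apply/funext => i; exact: theta_scale.
exact: half_pow_sum_squares_scale.
Qed.

Lemma image_gen_indep x (w : calL x) (e e' : n.-tuple (calE x)) :
  orthonormal_basis e -> orthonormal_basis e' -> image_gen w e' = image_gen w e.
Proof.
by move=> oe oe'; rewrite /image_gen (sum_eI2_indep p n_gt0 oe oe').
Qed.

(** Such a map sends w^{⊗pm} to [image_gen w e] for every generator w of L_x and
    every orthonormal basis e of E_x. Quantifying over all choices leaves each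
    later property free to use the choice that suits it. *)
Definition is_canonical_map x (phi : 'Hom(tpow (calL x) (p * m), tpow (Omega L D p x) m)) :=
  forall (w : calL x) (l : dual (calL x)) (e : n.-tuple (calE x)),
    l w = 1 -> orthonormal_basis e ->
    forall t, phi t = teval t (fun=> l) *: image_gen w e.

(** One choice of w and e defines the map. Another generator aw has the dual
    functional divided by a, and the factors a^{pm} cancel; another orthonormal
    basis gives the same sum of squares. *)
Lemma exists_canonical_map x : exists phi, is_canonical_map (x := x) phi.
Proof.
have [w [l [e [lw oe]]]] := exists_frame D_Dpm x.
have lin : linear (fun t : tpow (calL x) (p * m) => teval t (fun=> l) *: image_gen w e).
  by move=> a t t'; rewrite tevalD tevalZ scalerDl scalerA.
exists (linfun (fun t : tpow (calL x) (p * m) => teval t (fun=> l) *: image_gen w e)).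
move=> w' l' e' lw' oe' t; rewrite (linfunE lin).
rewrite (image_gen_indep w' oe oe').
have dL := dim_calL L x.
rewrite [in RHS](line_gen dL lw w') image_gen_scale scalerA.
rewrite (teval_line dL lw' t (fun=> l)) prodr_const card_ord mulrC.
by congr (_ *: _); rewrite mulrC.
Qed.

(** The functional number j is the evaluation at the tangent vector that sends w
    to e_j. *)
Lemma orthonormal_dual x (w : calL x) (l : dual (calL x)) (e : n.-tuple (calE x)) :
  l w = 1 -> orthonormal_basis e ->
  exists lam : 'I_n -> dual (dualB (tangentB L D) x),
    forall i j : 'I_n, lam j (theta w e`_i) = (i == j)%:R :> C.
Proof.
move=> lw [_ ee].
pose phi j : 'Hom(calL x, calE x) := linfun (fun u : calL x => l u *: e`_j).
have phiE (j : 'I_n) : phi j w = e`_j.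
  rewrite linfunE ?lw ?scale1r // => a u u'.
  by rewrite linearP scalerDl -scalerA.
exists (fun j => linfun (fun q : dual 'Hom(calL x, calE x) => q (phi j))).
move=> i j; rewrite linfunE; last first.
  by move=> a q q'; rewrite add_lfunE scale_lfunE.
rewrite (thetaE w _ (phi j)) phiE; exact: ee.
Qed.

Lemma image_gen_neq0 x (w : calL x) (l : dual (calL x)) (e : n.-tuple (calE x)) :
  l w = 1 -> orthonormal_basis e -> image_gen w e != 0.
Proof.
move=> lw oe; rewrite image_genE half_pow_neq0 //.
have [lam lamE] := orthonormal_dual lw oe.
exact: (sum_squares_neq0 n_gt0 p_le_n lamE).
Qed.

Lemma image_gen_sym2 x (w : calL x) (e : n.-tuple (calE x)) :
  image_gen w e \in sym2_pow (Omega L D p x) m.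
Proof.
rewrite image_genE; apply: half_pow_sym2 => //; apply: sum_squares_sym2.
by rewrite pnatr_eq0.
Qed.

End Pointwise.

(** * Equivariance *)

Section Conjugation.
Variables (K : fieldType) (V1 V2 W1 W2 : vectType K).
Variables (a : 'Hom(V1, V2)) (b : 'Hom(W1, W2)).
Hypotheses (aI : lker a = 0%VS) (aS : limg a = fullv) (bS : limg b = fullv).

(** The action on a dual bundle uses the inverse of the action on the bundle.
    When a is bijective and b is onto, so is conjugation; psi is then the
    conjugate of its preimage phi, and psi(a w) = b (phi w). *)
Lemma conj_hom_inv (psi : 'Hom(V2, W2)) (w : V1) :
  b (((linfun (fun phi : 'Hom(V1, W1) => (b \o phi \o a^-1)%VF))^-1)%VF psi w)
  = psi (a w).
Proof.
set c := linfun _.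
have cE phi : c phi = (b \o phi \o a^-1)%VF.
  apply: linfunE => t p q; apply/lfunP => v.
  by rewrite !(comp_lfunE, add_lfunE, scale_lfunE) linearP.
have aK : cancel a (a^-1)%VF by apply: lker0_lfunK; apply/eqP.
have psi_in : psi \in limg c.
  suff -> : psi = c (b^-1 \o psi \o a)%VF by rewrite memv_img ?memvf.
  apply/lfunP => v; rewrite cE !comp_lfunE.
  by rewrite !limg_lfunVK ?bS ?aS ?memvf.
rewrite -[in RHS](limg_lfunVK psi_in) [in RHS]cE !comp_lfunE.
by rewrite aK.
Qed.

End Conjugation.

Lemma nth_map_tuple (U1 U2 : zmodType) n (f : U1 -> U2) (e : n.-tuple U1) (i : 'I_n) :
  (map_tuple f e)`_i = f e`_i.
Proof. by rewrite (nth_map 0) ?size_tuple. Qed.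

Section Equivariance.
Variables (R : realType) (n : nat) (L : lattice n.+2).
Local Notation C := R[i].
Variable D : set (projsp R[i] n.+2).
Local Notation form := (@form R n L).
Local Notation calE := (calE L D).
Local Notation calL := (calL L D).
Local Notation calLperp := (calLperp L D).
Local Notation formE := (@formE R n L D).
Hypothesis D_Dpm : forall x, D x -> Dpm L x.
Variable g : Oplus L D.

Lemma orth_linE v : orth_lin g v = map_mx (real_complex R) (orth_mx g) *m v.
Proof. by rewrite linfunE // => a u w; rewrite linearP. Qed.

Lemma form_orth u v : form (orth_lin g u) (orth_lin g v) = form u v.
Proof.
rewrite !orth_linE /Defs.form trmx_mul.
set M := map_mx _ _.
have gE : M^T *m gram_in C L *m M = gram_in C L.
  have -> : gram_in C L = map_mx (real_complex R) (gram_in R L).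
    by apply/matrixP => i j; rewrite !mxE rmorph_int.
  by rewrite map_trmx -!map_mxM orth_mxP.
by rewrite mulmxA -(mulmxA u^T _ (gram_in C L)) -(mulmxA u^T _ M) gE.
Qed.

Section AtPoint.
Variable x : D.
Local Notation gx := (oplus_act g x).

Lemma vsval_act_calL (u : calL x) : vsval (act (calL) g x u) = orth_lin g (vsval u).
Proof.
rewrite [act _ _ _ _](@linfunE _ _ _ (fun u => vsproj (line gx) (orth_lin g (vsval u)))).
  by rewrite vsprojK // memv_img // subvsP.
by move=> a u1 u2; rewrite !linearP.
Qed.

Lemma vsval_act_calLperp (u : calLperp x) :
  vsval (act calLperp g x u) = orth_lin g (vsval u).
Proof.
rewrite [act _ _ _ _](@linfunE _ _ _ (fun u => vsproj (orthv L (line gx)) (orth_lin g (vsval u)))).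
  rewrite vsprojK //; apply/orthvP => v /memv_imgP[w wx ->].
  by rewrite form_orth; have /orthvP -> := subvsP u.
by move=> a u1 u2; rewrite !linearP.
Qed.

Lemma formE_act (u v : calE x) : formE (act calE g x u) (act calE g x v) = formE u v.
Proof.
have actE w : act calE g x w = vpi _ (act calLperp g x (vlift w)).
  rewrite [LHS](@linfunE _ _ _ (fun w => vpi _ (act calLperp g x (vlift w)))) //.
  by move=> a u1 u2; rewrite /vlift !linearP.
have [q _] := D_Dpm (set_mem (valP gx)).
transitivity (form (vsval (act calLperp g x (vlift u))) (vsval (act calLperp g x (vlift v)))).
  rewrite (actE u) (actE v).
  exact: (formE_pi (act calLperp g x (vlift u)) (act calLperp g x (vlift v)) q).
rewrite (vsval_act_calLperp (vlift u)) (vsval_act_calLperp (vlift v)).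
exact: form_orth.
Qed.

Lemma lker_act_calL : lker (act calL g x) = 0%VS.
Proof.
apply/eqP/lker0P => u v /(congr1 vsval); rewrite !vsval_act_calL => uv.
by apply: val_inj; move/eqP: (orth_lin_inj g) => /lker0P; apply.
Qed.

Lemma limg_act_calL : limg (act calL g x) = fullv.
Proof.
apply/eqP; rewrite eqEdim subvf /= limg_dim_eq ?lker_act_calL ?capv0 //.
by rewrite (dim_calL L x) (dim_calL L gx).
Qed.

(** An isometry of a nondegenerate space is injective: the coordinates of u in
    an orthonormal basis are read off from the form. *)
Lemma lker_act_calE : lker (act calE g x) = 0%VS.
Proof.
have [_ [_ [e [_ [eb ee]]]]] := exists_frame D_Dpm x.
apply/eqP; rewrite -subv0; apply/subvP => u; rewrite memv_ker memv0 => /eqP u0.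
apply/eqP; rewrite (orthonormal_expansion (@formEC _ _ _ _ x) (@formEP _ _ _ _ x) eb ee u).
apply: big1 => i _.
rewrite -(formE_act u e`_i) u0 formEC.
by rewrite (bilin0 (@formEP _ _ _ _ gx)) scale0r.
Qed.

Lemma limg_act_calE : limg (act calE g x) = fullv.
Proof.
apply/eqP; rewrite eqEdim subvf /= limg_dim_eq ?lker_act_calE ?capv0 //.
by rewrite (dim_calE D_Dpm x) (dim_calE D_Dpm gx).
Qed.

(** Naturality of w ⊗ e, from the invariance of the form on E. *)
Lemma theta_act (w : calL x) (e : calE x) :
  theta (act calL g x w) (act calE g x e) =
  act (dualB (tangentB L D)) g x (theta w e).
Proof.
apply/lfunP => psi; rewrite thetaE.
transitivity (theta w e ((act (tangentB L D) g x)^-1%VF psi)).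
  rewrite thetaE -formE_act; congr (formE _ _).
  by rewrite (conj_hom_inv lker_act_calL limg_act_calL limg_act_calE).
rewrite [act _ _ _ _]linfunE.
  by rewrite !comp_lfunE id_lfunE.
move=> a p q; apply/lfunP => v.
by rewrite !(comp_lfunE, add_lfunE, scale_lfunE) !id_lfunE.
Qed.

Lemma image_gen_act p m (w : calL x) (e : n.-tuple (calE x)) :
  image_gen p m (act calL g x w) (map_tuple (act calE g x) e) =
  act (tpowB (Omega L D p) m) g x (image_gen p m w e).
Proof.
rewrite (image_genE p m w e) image_genE.
rewrite [RHS]tpow_map_half_pow; congr (half_pow _ m).
transitivity (sum_squares p ((act (dualB (tangentB L D)) g x) \o (fun i : 'I_n => theta w e`_i))).
  apply: eq_sum_squares => i.
  exact: (etrans (congr1 (theta (act calL g x w))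
    (nth_map_tuple (act calE g x) e i)) (theta_act w e`_i)).
by rewrite -sum_squares_map.
Qed.

Lemma act_orthonormal (e : n.-tuple (calE x)) :
  orthonormal_basis e -> orthonormal_basis (map_tuple (act calE g x) e).
Proof.
move=> [_ ee]; apply: formE_orthonormal_basis => // i j.
by rewrite (nth_map_tuple (act calE g x) e i) (nth_map_tuple (act calE g x) e j) formE_act ee.
Qed.

End AtPoint.
End Equivariance.

(** * Holomorphic maps on the domain *)

Section HolomorphicMaps.
Variables (R : realType) (n : nat).
Local Notation C := R[i].
Local Notation Vn := ('cV[C]_n.+2 : normedModType C).
Variable D : set (projsp R[i] n.+2).

(** Nearness to x as it is tested by [hol_map]: on the cone over D, around every
    nonzero vector of the line x. *)
Definition near_cone (x : D) (P : D -> Prop) := forall w : Vn,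
  w \in line x -> w != 0 -> \forall v \near w, forall y : D, v \in line y -> P y.

(** The topology of D is induced by the quotient topology of projective space, so
    a neighbourhood of x has an open cone over it. *)
Lemma nbhs_near_cone (x : D) (P : D -> Prop) : nbhs x P -> near_cone x P.
Proof.
case=> U [[A oA AU] Ux UP] w wx w0.
have : open (cone_over A) by exact: oA.
rewrite openE => /(_ w) coneO.
have : cone_over A w.
  by split=> //; exists (val x) => //; move: Ux; rewrite -AU.
move/coneO; apply: filterS => v [v0 [z Oz vz]] y vy.
apply: UP; rewrite -AU /=.
by have -> : set_val y = z by exact: (projP vy vz v0).
Qed.

Lemma hol_map_near (W : normedModType C) (x : D) (s t : D -> W) :
  near_cone x (fun y => s y = t y) -> hol_map x s -> hol_map x t.
Proof.
move=> st hs w wx w0; have [F dF sF] := hs w wx w0; exists F => //.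
near=> v => y vy; transitivity (s y); last by move: y vy; near: v.
by apply/esym; move: y vy; near: v; exact: st.
Unshelve. all: by end_near.
Qed.

Lemma eq_hol_map (W : normedModType C) (x : D) (s t : D -> W) :
  s =1 t -> hol_map x s -> hol_map x t.
Proof. by move=> /funext ->. Qed.

Lemma hol_map_cst (W : normedModType C) (x : D) (c : W) : hol_map x (fun=> c).
Proof.
move=> w _ _; exists (cst c); near=> v => //; exact: differentiable_cst.
Unshelve. all: by end_near.
Qed.

Lemma hol_mapD (W : normedModType C) (x : D) (s t : D -> W) :
  hol_map x s -> hol_map x t -> hol_map x (fun y => s y + t y).
Proof.
move=> hs ht w wx w0; have [F dF sF] := hs w wx w0; have [G dG tG] := ht w wx w0.
exists (F + G).
  by near=> v; apply: differentiableD; near: v.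
near=> v => y vy; congr (_ + _); move: y vy; near: v => //.
Unshelve. all: by end_near.
Qed.

Lemma hol_mapM (x : D) (s t : D -> C^o) :
  hol_map x s -> hol_map x t -> hol_map x (fun y => (s y * t y : C^o)).
Proof.
move=> hs ht w wx w0; have [F dF sF] := hs w wx w0; have [G dG tG] := ht w wx w0.
exists ((F : Vn -> C) * G).
  by near=> v; apply: differentiableM; near: v.
near=> v => y vy; congr (_ * _); move: y vy; near: v => //.
Unshelve. all: by end_near.
Qed.

Lemma hol_map_sum (I : Type) (r : seq I) (P : pred I) (x : D) (s : I -> D -> C^o) :
  (forall i, P i -> hol_map x (s i)) ->
  hol_map x (fun y => \sum_(i <- r | P i) s i y : C^o).
Proof.
move=> hs; elim: r => [|i r IH].
  under [X in hol_map _ X]eq_fun do rewrite big_nil.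
  exact: hol_map_cst.
under [X in hol_map _ X]eq_fun do rewrite big_cons.
by case Pi: (P i) => //; apply: hol_mapD => //; exact: hs.
Qed.

Lemma hol_map_prod (I : Type) (r : seq I) (x : D) (s : I -> D -> C^o) :
  (forall i, hol_map x (s i)) ->
  hol_map x (fun y => \prod_(i <- r) (s i y : C) : C^o).
Proof.
move=> hs; elim: r => [|i r IH].
  under [X in hol_map _ X]eq_fun do rewrite big_nil.
  exact: hol_map_cst.
under [X in hol_map _ X]eq_fun do rewrite big_cons.
exact: hol_mapM.
Qed.

Lemma hol_map_coord (x : D) (s : D -> Vn) i :
  hol_map x s -> hol_map x (fun y => s y i ord0 : C^o).
Proof.
move=> hs w wx w0; have [F dF sF] := hs w wx w0.
exists (fun v => F v i ord0).
  near=> v; have dFv : differentiable F v by near: v.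
  exact: (differentiable_comp dFv (differentiable_coord (F v) i ord0)).
by near=> v => y vy; congr (fun_of_matrix _ _ _); move: y vy; near: v.
Unshelve. all: by end_near.
Qed.

Lemma hol_map_of_coord (x : D) (s : D -> Vn) :
  (forall i, hol_map x (fun y => s y i ord0 : C^o)) -> hol_map x s.
Proof.
move=> hs w wx w0.
have /choice[F FP] : forall i, exists F : Vn -> C^o,
    (\forall v \near w, differentiable F v) /\
    \forall v \near w, forall y : D, v \in line y -> s y i ord0 = F v.
  by move=> i; have [F dF sF] := hs i w wx w0; exists F.
exists (\sum_i (fun v => F i v *: (delta_mx i ord0 : Vn))).
  have dF : \forall v \near w, forall i, differentiable (F i) v.
    by apply: (@filter_forall _ _ _ (nbhs w) (nbhs_filter w)) => i; have [] := FP i.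
  near=> v; apply: differentiable_sum => i; apply: differentiableZl.
  by move: i; near: v.
have sF : \forall v \near w, forall i (y : D), v \in line y -> s y i ord0 = F i v.
  by apply: (@filter_forall _ _ _ (nbhs w) (nbhs_filter w)) => i; have [] := FP i.
near=> v => y vy; rewrite fct_sumE.
rewrite [LHS]matrix_sum_delta; apply: eq_bigr => i _.
rewrite big_ord1; congr (_ *: _); move: i y vy; near: v.
exact: sF.
Unshelve. all: by end_near.
Qed.

Variable L : lattice n.+2.
Local Notation form := (@form R n L).

Lemma form_sum u v :
  form u v = \sum_j \sum_i u i ord0 * gram_in C L i j * v j ord0.
Proof.
rewrite /Defs.form mxE; apply: eq_bigr => j _.
by rewrite mxE mulr_suml; apply: eq_bigr => i _; rewrite mxE.
Qed.

Lemma hol_map_form (x : D) (s t : D -> Vn) : hol_map x s -> hol_map x t ->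
  hol_map x (fun y => form (s y) (t y) : C^o).
Proof.
move=> hs ht; under [X in hol_map _ X]eq_fun do rewrite form_sum.
apply: hol_map_sum => j _; apply: hol_map_sum => i _; apply: hol_mapM.
  by apply: hol_mapM; [exact: hol_map_coord|exact: hol_map_cst].
exact: hol_map_coord.
Qed.

Lemma differentiable_form (eta : 'cV[C]_n.+2) (w : Vn) :
  differentiable (fun v : Vn => form v eta : C^o) w.
Proof.
have -> : (fun v : Vn => form v eta : C^o) =
    \sum_j \sum_i ((gram_in C L i j * eta j ord0) *:
                    (fun v : 'cV[C]_n.+2 => v i ord0 : C^o)).
  apply/funext => v; rewrite form_sum fct_sumE; apply: eq_bigr => j _.
  rewrite fct_sumE; apply: eq_bigr => i _.
  by rewrite -[RHS]/(_ * _ * _) -mulrA mulrC.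
apply: differentiable_sum => j; apply: differentiable_sum => i.
by apply: differentiableZ; exact: differentiable_coord.
Qed.

Lemma near_form_neq0 (eta : 'cV[C]_n.+2) (w : Vn) : form w eta != 0 ->
  \forall v \near w, form v eta != 0.
Proof.
move=> weta; have /differentiable_continuous := differentiable_form eta w.
by move=> /cvgr_neq0; apply.
Qed.

End HolomorphicMaps.

(** * Holomorphic sections *)

Section HolomorphicSections.
Variables (R : realType) (n : nat) (L : lattice n.+2).
Local Notation C := R[i].
Local Notation V := 'cV[C]_n.+2.
Local Notation Vn := ('cV[C]_n.+2 : normedModType C).
Variable D : set (projsp R[i] n.+2).
Local Notation form := (@form R n L).
Local Notation calE := (calE L D).
Local Notation calL := (calL L D).
Local Notation formE := (@formE R n L D).
Hypothesis D_Dpm : forall x, D x -> Dpm L x.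

(** Unfolding the recursion: a section of F^{⊗k} is holomorphic when its
    contractions with k holomorphic sections of the dual of F are holomorphic
    functions. *)
Lemma hol_tpowP (F : bundle L D) k x (s : forall y, tpow (F y) k) :
  tpow_hol x s <->
  forall l : 'I_k -> forall y, dual (F y), (forall a, hol (b := dualB F) x (l a)) ->
    hol_map x (fun y => teval (s y) (fun a => l a y) : C^o).
Proof.
elim: k s => [|k IH] s; first by split=> [h l _|/(_ (fun _ _ => 0))]; [exact: h|apply; case].
split=> [hs l hl|hs l hl].
  have /IH := hs (l ord0) (hl ord0).
  by move=> /(_ (fun a => l (lift ord0 a))); apply=> a; exact: hl.
apply/IH => l' hl'.
have := hs (fun i => if unlift ord0 i is Some j then l' j else l).
move=> h; have {}h := h _.
have hh : forall a : 'I_k.+1, hol (b := dualB F) x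
    (if unlift ord0 a is Some j then l' j else l).
  by move=> a; case: unliftP.
apply: eq_hol_map (h hh) => y /=; rewrite unlift_none.
by apply: eq_teval => a; rewrite liftK.
Qed.

(** Holomorphic sections of E = L^⊥/L are those with a local holomorphic lift,
    and the form on E is computed on lifts. *)
Lemma hol_formE x (u v : forall y, calE y) :
  hol (b := calE) x u -> hol (b := calE) x v ->
  hol_map x (fun y => formE (u y) (v y) : C^o).
Proof.
move=> [s hs us] [t ht vt].
have h : hol_map x (fun y => form (vsval (s y)) (vsval (t y)) : C^o).
  exact: hol_map_form hs ht.
apply: hol_map_near h.
apply: nbhs_near_cone; near=> y.
have [q _] := D_Dpm (set_mem (valP y)).
have uy : u y = vpi _ (s y) by near: y.
have vy : v y = vpi _ (t y) by near: y.
by rewrite uy vy; exact/esym/(formE_pi (s y) (t y) q).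
Unshelve. all: by end_near.
Qed.

Lemma hol_theta x (w : forall y, calL y) (u : forall y, calE y) :
  hol (b := calL) x w -> hol (b := calE) x u ->
  hol (b := dualB (tangentB L D)) x (fun y => theta (w y) (u y)).
Proof.
move=> hw hu phi hphi.
have h := hol_formE hu (hphi w hw).
by apply: eq_hol_map h => y; exact/esym/thetaE.
Qed.

(** A contraction of a wedge is a determinant of holomorphic functions. *)
Lemma hol_wedge (F : bundle L D) p x (s : 'I_p -> forall y, F y) :
  (forall a, hol (b := F) x (s a)) ->
  hol (b := extB p F) x (fun y => wedge (fun a => s a y)).
Proof.
move=> hs; apply/hol_tpowP => l hl.
have h : hol_map x (fun y => \sum_(g : 'S_p)
    ((-1) ^+ g * \prod_a (l a y (s (g a) y) : C) : C^o)).
  apply: hol_map_sum => g _; apply: hol_mapM; first exact: hol_map_cst.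
  by apply: hol_map_prod => a; exact: hl.
apply: eq_hol_map h => y; rewrite vsval_wedge teval_alt.
by apply: eq_bigr => g _; congr (_ * _); apply: eq_bigr => a _; rewrite mxE.
Qed.

Lemma hol_sum_squares (F : bundle L D) p x (s : 'I_n -> forall y, F y)
    (l : 'I_2 -> forall y, dual (extB p F y)) :
  (0 < n)%N -> (forall i, hol (b := F) x (s i)) ->
  (forall a, hol (b := dualB (extB p F)) x (l a)) ->
  hol_map x (fun y => teval (sum_squares p (fun i => s i y)) (fun a => l a y) : C^o).
Proof.
move=> n0 hs hl; pose i0 := Ordinal n0.
pose wI (I : {set 'I_n}) y : extB p F y :=
  wedge (fun a : 'I_p => s (nth i0 (enum I) a) y).
have h : hol_map x (fun y => \sum_(I : {set 'I_n} | #|I| == p)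
    ((l ord0 y (wI I y) : C) * l (lift ord0 ord0) y (wI I y) : C^o)).
  apply: hol_map_sum => I _; have hI : hol (b := extB p F) x (wI I).
    by apply: (hol_wedge (s := fun a => s (nth i0 (enum I) a))) => a.
  by apply: hol_mapM; exact: hl.
apply: eq_hol_map h => y; rewrite teval_sum; apply: eq_bigr => I cI.
have -> : wI I y = wedge_set p (fun i => s i y) I.
  apply: eq_wedge => a; rewrite (nth_map i0) // -cardE (eqP cI) //.
by rewrite teval_pure2.
Qed.

Lemma hol_half_pow (F : bundle L D) x (T : forall y, tpow (F y) 2) m
    (l : 'I_m -> forall y, dual (F y)) :
  (forall l' : 'I_2 -> forall y, dual (F y),
     (forall a, hol (b := dualB F) x (l' a)) ->
     hol_map x (fun y => teval (T y) (fun a => l' a y) : C^o)) ->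
  (forall a, hol (b := dualB F) x (l a)) ->
  hol_map x (fun y => teval (half_pow (T y) m) (fun a => l a y) : C^o).
Proof.
move=> hT; elim: m {-2}m (leqnn m) l => [|N IH] [|[|m]] // lemN l hl.
- have h : hol_map x (fun=> 1 : C^o) by exact: hol_map_cst.
  exact: eq_hol_map h.
- have h : hol_map x (fun=> 1 : C^o) by exact: hol_map_cst.
  exact: eq_hol_map h.
- have h : hol_map x (fun=> 0 : C^o) by exact: hol_map_cst.
  by apply: eq_hol_map h => y; exact/esym/teval0.
have h : hol_map x (fun y =>
    ((teval (T y) (fun i => l (lshift m i) y) : C) *
     teval (half_pow (T y) m) (fun i => l (rshift 2 i) y) : C^o)).
  apply: hol_mapM.
    by apply: (hT (fun i => l (lshift m i))) => a; exact: hl.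
  by apply: (IH m (ltnW lemN) (fun i => l (rshift 2 i))) => a; exact: hl.
by apply: eq_hol_map h => y; rewrite teval_half_pow.
Qed.

Variables (eta : V) (x : D) (w0 : V).
Hypotheses (w0x : w0 \in line x) (w0eta : form w0 eta != 0).

Lemma form_line_neq0 w : w \in line x -> w != 0 -> form w eta != 0.
Proof.
move=> wx w_neq0; move: w0eta; have := w0x.
rewrite (lineE wx w_neq0) => /vlineP[a ->].
by rewrite formZl mulf_eq0 negb_or => /andP[].
Qed.

Lemma near_cone_in_chart : near_cone x (in_chart L eta).
Proof.
move=> w wx w_neq0; have near_eta := near_form_neq0 (form_line_neq0 wx w_neq0).
near=> v => y vy; have veta : form v eta != 0 by near: v.
exact: (norm_genE vy veta).1.
Unshelve. all: by end_near.
Qed.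

Lemma hol_norm_gen : hol_map x (norm_gen L eta : D -> Vn).
Proof.
apply: hol_map_of_coord => i w wx w_neq0.
have near_eta := near_form_neq0 (form_line_neq0 wx w_neq0).
exists ((fun v : Vn => (form v eta)^-1 : C) * (fun v : Vn => v i ord0 : C)).
  near=> v; apply: differentiableM; last exact: differentiable_coord.
  apply: differentiableV; first exact: differentiable_form.
  by near: v.
near=> v => y vy; have veta : form v eta != 0 by near: v.
by rewrite (norm_genE vy veta).2 mxE.
Unshelve. all: by end_near.
Qed.

Lemma hol_gen_sec : hol (b := calL) x (gen_sec L eta (D := D)).
Proof.
by apply: eq_hol_map hol_norm_gen => y; rewrite vsval_gen_sec.
Qed.

Lemma hol_dual_sec : hol (b := dualB calL) x (dual_sec L eta (D := D)).
Proof.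
move=> s hs.
have h : hol_map x (fun y => form eta (vsval (s y)) : C^o).
  by apply: hol_map_form => //; exact: hol_map_cst.
by apply: eq_hol_map h => y; rewrite dual_secE.
Qed.

Variable e : 'I_n -> V.

Lemma hol_perp_vec i : hol_map x (perp_vec L eta e i : D -> Vn).
Proof.
apply: hol_map_of_coord => k.
have h : hol_map x (fun y => (e i k ord0 : C^o) +
    ((- eta k ord0) * form (e i) (norm_gen L eta y) : C^o)).
  apply: hol_mapD; first exact: hol_map_cst.
  apply: hol_mapM; first exact: hol_map_cst.
  by apply: hol_map_form; [exact: hol_map_cst|exact: hol_norm_gen].
apply: eq_hol_map h => y; rewrite !mxE; congr (_ + _).
by rewrite mulNr mulrC.
Qed.

Lemma hol_frame_sec i : hol (b := calE) x (frame_sec L eta e i (D := D)).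
Proof.
exists (perp_sec L eta e i (D := D)); last by near=> y.
apply: hol_map_near (hol_perp_vec i) => w wx w_neq0.
have r := near_cone_in_chart wx w_neq0.
near=> v => y vy; apply/esym/vsval_perp_sec.
by move: y vy; near: v.
Unshelve. all: by end_near.
Qed.

End HolomorphicSections.

(** * The embedding *)

Section Embedding.
Variables (R : realType) (n : nat) (L : lattice n.+2).
Local Notation C := R[i].
Variable D : set (projsp R[i] n.+2).
Local Notation calE := (calE L D).
Local Notation calL := (calL L D).
Hypothesis D_Dpm : forall x, D x -> Dpm L x.
Variables (p m : nat).
Hypotheses (p_gt0 : (0 < p)%N) (p_le_n : (p <= n)%N) (m_even : ~~ odd m).
Variable Phi : forall x : D, 'Hom(tpowB calL (p * m) x, tpowB (Omega L D p) m x).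
Hypothesis PhiP : forall x, @is_canonical_map R n L D p m x (Phi x).

(** Near x the map is computed with the local frame: it multiplies the
    coordinate of the section s, which is holomorphic, by a tensor built from
    the holomorphic sections w and f_i. *)
Lemma embedding_holomorphic : holomorphic Phi.
Proof.
move=> x s hs; apply/hol_tpowP => l hl.
have [v [eta [e [vx veta etaeta eeta ee]]]] := adapted_frame D_Dpm x.
have veta0 : form L v eta != 0 by rewrite veta oner_neq0.
pose w := gen_sec L eta (D := D); pose lam := dual_sec L eta (D := D).
pose f i := frame_sec L eta e i (D := D).
pose T y := sum_squares p (fun i => theta (w y) (f i y)).
have hT (l' : 'I_2 -> forall y, dual (Omega L D p y)) :
    (forall a, hol (b := dualB (Omega L D p)) x (l' a)) ->
    hol_map x (fun y => teval (T y) (fun a => l' a y) : C^o).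
  move=> hl'; apply: (hol_sum_squares (s := fun i y => theta (w y) (f i y))) => //.
    exact: leq_trans p_le_n.
  move=> i; apply: hol_theta => //; first exact: (hol_gen_sec vx veta0).
  exact: (hol_frame_sec vx veta0 e i).
have hc : hol_map x (fun y => teval (s y) (fun=> lam y) : C^o).
  move/hol_tpowP: hs => /(_ (fun=> lam)); apply=> _.
  exact: hol_dual_sec.
have h := hol_mapM hc (hol_half_pow hT hl).
apply: hol_map_near h => w' w'x w'0.
have r := near_cone_in_chart vx veta0 w'x w'0.
near=> v' => y v'y.
have ry : in_chart L eta y by move: y v'y; near: v'.
rewrite (PhiP (dual_gen_sec ry) (frame_basis D_Dpm etaeta eeta ee ry) (s y)).
have thetaE : (fun i : 'I_n => theta (w y) (frame_tuple L eta e y)`_i) =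
              (fun i => theta (w y) (f i y)).
  by apply/funext => i; exact: (congr1 (theta (w y)) (frame_tupleE L eta e y i)).
have image_genE : image_gen p m (w y) (frame_tuple L eta e y) = half_pow (T y) m.
  apply: (etrans (image_genE p m (w y) (frame_tuple L eta e y))).
  exact: (congr1 (fun g => half_pow (sum_squares p g) m) thetaE).
rewrite tevalZ.
exact/esym/(congr1 (fun t => teval (s y) (fun=> lam y) * teval t (fun a => l a y)) image_genE).
Unshelve. all: by end_near.
Qed.

(** At gx the map may be computed with gw and ge, the images of a generator and
    an orthonormal basis at x. *)
Lemma embedding_equivariant : equivariant Phi.
Proof.
move=> g x u.
have [w [l0 [e [lw0 oe]]]] := exists_frame D_Dpm x.
have w0 : w != 0 by exact: (dual_gen_neq0 lw0).
have gw0 : act calL g x w != 0.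
  have /lker0P inj : lker (act calL g x) == 0%VS by rewrite lker_act_calL.
  by apply: contraNneq w0 => gw0; apply/eqP/inj; rewrite gw0 linear0.
have [l lgw] := exists_dual (dim_calL L (oplus_act g x)) gw0.
have lw : (l \o act calL g x)%VF w = 1 by rewrite comp_lfunE.
rewrite (PhiP lgw (act_orthonormal D_Dpm g oe)) (PhiP lw oe).
rewrite linearZ; apply: (f_equal2 (fun c t => c *: t)).
  exact: teval_tpow_map.
exact: image_gen_act.
Qed.

Lemma embedding_injective : fiberwise_injective Phi.
Proof.
move=> x; have [w [l [e [lw oe]]]] := exists_frame D_Dpm x.
apply: (lker_evaluation (dim_calL L x) lw (PhiP lw oe)).
exact: image_gen_neq0 lw oe.
Qed.

Lemma limg_embedding x (w : calL x) (e : n.-tuple (calE x)) :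
  w != 0 -> orthonormal_basis e ->
  limg (Phi x) = <[image_gen p m w e]>%VS.
Proof.
move=> w0 oe; have [l lw] := exists_dual (dim_calL L x) w0.
exact: (limg_evaluation lw (PhiP lw oe)).
Qed.

Lemma limg_embedding_sym2 x : (limg (Phi x) <= sym2_pow (Omega L D p x) m)%VS.
Proof.
have [w [l [e [lw oe]]]] := exists_frame D_Dpm x.
rewrite (limg_embedding (dual_gen_neq0 lw) oe) -memvE.
exact: image_gen_sym2.
Qed.

End Embedding.

Theorem proposition2p3 (R : realType) (n : nat) (L : lattice n.+2)
    (L_sign : has_signature R L 2 n)
    (D : set (projsp R[i] n.+2)) (D_domain : is_domain L D)
    (p : nat) (p_gt0 : (0 < p)%N) (p_le_n : (p <= n)%N)
    (m : nat) (m_gt0 : (0 < m)%N) (m_even : ~~ odd m) :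
  exists Phi : forall x : D,
      'Hom(tpowB (calL L D) (p * m) x, tpowB (Omega L D p) m x),
    [/\ holomorphic Phi,
        equivariant Phi,
        fiberwise_injective Phi,
        forall x : D, (limg (Phi x) <= sym2_pow (Omega L D p x) m)%VS &
        forall (x : D) (w : calL L D x) (e : n.-tuple (calE L D x)),
          w != 0 -> orthonormal_basis e ->
          limg (Phi x) = <[half_pow (iso_Omega2 p w (sum_eI2 p e)) m]>%VS].
Proof.
have D_Dpm : forall x, D x -> Dpm L x.
  by case: D_domain => x0 _ ->; exact: connected_component_sub.
pose Phi x := projT1 (cid (exists_canonical_map D_Dpm p_gt0 p_le_n m_even x)).
have PhiP x : is_canonical_map (Phi x) :=
  projT2 (cid (exists_canonical_map D_Dpm p_gt0 p_le_n m_even x)).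
exists Phi; split.
- exact: embedding_holomorphic.
- exact: embedding_equivariant.
- exact: embedding_injective.
- exact: limg_embedding_sym2.
- exact: limg_embedding.
Qed.
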